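(* (i) For each $n\in\mathbb{N}$, the system $(E_n)$ has a unique solution $c^n=(c^n_k)_{k\ge 1}$. (ii) As $n\to\infty$, $$m_0(c^n)\sim \frac{1}{|a_1'|\,n^{1/3}},\qquad m_2(c^n)\sim \frac{n^{2/3}}{|a_1'|}.$$
   Context: $\mathbb{N}=\{1,2,\dots\}$. For a $[0,\infty)$-valued sequence $u=(u_k)_{k\ge1}$ and $i\ge 0$, put $m_i(u)=\sum_{k\ge1}k^iu_k$. For $n\in\mathbb{N}$, a sequence $c^n=(c^n_k)_{k\ge1}$ of nonnegative real numbers is said to solve $(E_n)$ if $m_1(c^n)=1$ and, for all $k\ge2$, $\left(2+\frac{k-1}{n}\right)c^n_k=\frac{1}{m_0(c^n)}\sum_{i=1}^{k-1}c^n_ic^n_{k-i}$. The Airy function is $\mathrm{Ai}(x)=\pi^{-1}\int_0^\infty\cos(t^3/3+xt)\,dt$ for real $x$, and $a_1'<0$ denotes the largest negative zero of its derivative $\mathrm{Ai}'$. The notation $u_n\sim v_n$ means $u_n/v_n\to1$. *)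

(* Defs.v *)
From Stdlib Require Import Reals.
From Coquelicot Require Import Coquelicot.
Open Scope R_scope.

(** Sequences [(u_k)_{k >= 1}] are functions [nat -> R] whose value at 0 is
    never used.  For nonnegative [u] the partial sums are nondecreasing, so
    [Lim_seq] is their limit in [[0, +oo]]. *)
Definition moment (i : nat) (u : nat -> R) : Rbar :=
  Lim_seq (fun N => sum_n_m (fun k => INR k ^ i * u k) 1 N).

(** If the first moment is 1, then [moment 0 c] is finite and positive, so
    neither [real] nor the division is degenerate. *)
Definition solves (n : nat) (c : nat -> R) : Prop :=
  (forall k : nat, (1 <= k)%nat -> 0 <= c k) /\
  moment 1 c = Finite 1 /\
  (forall k : nat, (2 <= k)%nat ->
     (2 + (INR k - 1) / INR n) * c k =
     1 / real (moment 0 c) *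
       sum_n_m (fun i => c i * c (k - i)%nat) 1 (k - 1)).

(** The integral is only conditionally convergent: [RInt_gen] is the limit of
    the integrals over [[0, T]] as [T] tends to infinity. *)
Definition Ai (x : R) : R :=
  / PI * RInt_gen (fun t => cos (t ^ 3 / 3 + x * t))
           (at_point 0) (Rbar_locally p_infty).

Definition largest_negative_zero (f : R -> R) (a : R) : Prop :=
  a < 0 /\ f a = 0 /\ (forall x : R, x < 0 -> f x = 0 -> x <= a).

(** [u] may be infinite; as [real p_infty = 0], a limit equal to 1 forces
    [u n] to be finite for all large [n]. *)
Definition asymp_equiv (u : nat -> Rbar) (v : nat -> R) : Prop :=
  is_lim_seq (fun n => real (u n) / v n) 1.

(* Main.v *)
Require Import Defs.
From Stdlib Require Import Reals Lra Lia Arith.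
From Coquelicot Require Import Coquelicot.
Open Scope R_scope.

(** The generating function [B] of [c^n / m_0], normalised to [B(y) = y + ...],
    satisfies the Riccati equation [(2 - 1/n) B + y B' / n = 2 y + B^2], and a
    solution of (E_n) corresponds to the unique [g > 0] with [B(g) = 1].  Setting
    [y = g] in the equation and in its derivative gives
    [1 / m_0 = g B'(g) = 1 + n (2 g - 1)] and [m_2 = 1 + 2 n g m_0].
    With [y = exp (s / n^(2/3)) / 2] and [B = 1 - v / n^(1/3)] the equation becomes
    [v' = - s - v^2 + O(n^(-1/3))], whose limit [r' = - s - r^2] is solved by
    [r = u' / u], [u s = Ai (- s)].  Since [u] and [u'] vanish at minus infinity,
    comparing [v] with [r] through the Wronskian-like function [u' - v u] shows
    that the zero [n^(2/3) ln (2 g)] of [v] is at most [|a_1'|], and comparing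
    with a shift of [u] by a small [d] shows that it converges to [|a_1'|]. *)

(** * The recursion and its generating function *)

(** The scaling comes from balancing the equation near y = 1/2, B = 1, where 2 B = 2 y + B^2 has a
    double root: in y B'/n = (2 y - 1) + (1 - B)^2 + B/n the first three terms become -v'/q^2, s/q^2
    and v^2/q^2 with q = n^(1/3), and B/n is smaller by a factor 1/q. The equation and its
    derivative are needed at g itself, so g must lie strictly inside the disk of convergence; this
    rests on a growth bound for the partial sums that is uniform in their length. In the comparison,
    v comes with no initial condition and only the bounds 0 <= v <= q. For the upper estimate the
    error terms have a favourable sign on the whole half line, so the comparison may start as far to
    the left as q requires. For the lower estimate the sign is wrong and the error is small on
    compact sets only, but at a fixed left end v >= 0 suffices. The integral for Ai cannot be
    differentiated twice under the sign, since t^2 cos (t^3/3 + x t) is not integrable up to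
    infinity, even conditionally; hence the detour through truncated integrals. The signs of Ai and
    Ai' follow from y'' = x y and decay alone. *)

Fixpoint coef_upto (a : R) (m : nat) : nat -> R :=
  match m with
  | O => fun _ => 1
  | S m' => fun k =>
      if (k <=? m')%nat then coef_upto a m' k
      else PS_mult (coef_upto a m') (coef_upto a m') m' / (2 + INR (S m') / a)
  end.

(** For [a = n], the solutions of the recursion in (E_n) are
    [c_(k+1) = m0 * coef a k * g ^ (k+1)], where [g = c_1 / m0]. *)
Definition coef (a : R) (k : nat) : R := coef_upto a k k.

(** Each coefficient depends on all earlier ones, which is not structural recursion. Stage [m] of
    [coef_upto] therefore tabulates the indices up to [m], with meaningless values beyond, and later
    stages leave the table unchanged. *)
Lemma coef_upto_stable (a : R) (m k : nat) :
  (k <= m)%nat -> coef_upto a m k = coef a k.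
Proof.
induction m as [|m IH]; intros Hk.
- now replace k with 0%nat by lia.
- destruct (Nat.eq_dec k (S m)) as [->|Hne]; [reflexivity|].
  cbn [coef_upto]. rewrite (proj2 (Nat.leb_le k m)) by lia. apply IH; lia.
Qed.

Lemma PS_mult_ext_le (u v : nat -> R) (m : nat) :
  (forall k, (k <= m)%nat -> u k = v k) -> PS_mult u u m = PS_mult v v m.
Proof.
intros H. apply sum_eq. intros i Hi. rewrite !H by lia. reflexivity.
Qed.

Lemma coef_0 (a : R) : coef a 0 = 1.
Proof. reflexivity. Qed.

Lemma weight_pos (a : R) (j : nat) : 1 <= a -> 0 < 2 + INR j / a.
Proof.
intros Ha. assert (0 <= INR j / a); [|lra].
apply Rdiv_le_0_compat; [apply pos_INR | lra].
Qed.

Lemma coef_S (a : R) (m : nat) : 1 <= a ->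
  (2 + INR (S m) / a) * coef a (S m) = PS_mult (coef a) (coef a) m.
Proof.
intros Ha. unfold coef at 1. cbn [coef_upto].
rewrite (proj2 (Nat.leb_gt (S m) m)) by lia.
rewrite (PS_mult_ext_le _ (coef a)) by (intros; now apply coef_upto_stable).
pose proof (weight_pos a (S m) Ha) as Hw.
set (w := 2 + INR (S m) / a) in *. field. lra.
Qed.

Lemma PS_mult_ge0 (u : nat -> R) (m : nat) :
  (forall k, (k <= m)%nat -> 0 <= u k) -> 0 <= PS_mult u u m.
Proof.
intros H. unfold PS_mult. assert (forall p, (p <= m)%nat ->
  0 <= sum_f_R0 (fun k => u k * u (m - k)%nat) p) as Hp.
{ induction p; intros Hp; simpl.
  - apply Rmult_le_pos; apply H; lia.
  - apply Rplus_le_le_0_compat; [apply IHp; lia|apply Rmult_le_pos; apply H; lia]. }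
apply Hp; lia.
Qed.

Lemma coef_ge0 (a : R) (k : nat) : 1 <= a -> 0 <= coef a k.
Proof.
intros Ha. induction k as [k IH] using lt_wf_ind.
destruct k as [|k]; [rewrite coef_0; lra|].
apply (Rmult_le_reg_l (2 + INR (S k) / a)); [now apply weight_pos|].
rewrite Rmult_0_r, coef_S by easy. apply PS_mult_ge0. intros; apply IH; lia.
Qed.

(** The exponents in the convolution add up to [S (S p)]. This homogeneity lets one coefficient
    sequence, rescaled by [m] and [x], describe all solutions; one factor [m] will cancel against
    1/m_0. *)
Lemma PS_mult_geom (u : nat -> R) (m x : R) (p : nat) :
  PS_mult (fun j => m * (u j * x ^ S j)) (fun j => m * (u j * x ^ S j)) p
  = m * (m * (PS_mult u u p * x ^ S (S p))).
Proof.
transitivity ((m * m * x ^ S (S p)) * PS_mult u u p); [|ring].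
unfold PS_mult. rewrite scal_sum. apply sum_eq. intros i Hi.
replace (S (S p)) with (S i + S (p - i))%nat by lia. rewrite pow_add. ring.
Qed.

(** The square of the partial sum contains every product with index sum at most [N], and its other
    products are nonnegative. *)
Lemma sum_PS_mult_le (u : nat -> R) (N : nat) :
  (forall k, 0 <= u k) ->
  sum_f_R0 (PS_mult u u) N <= sum_f_R0 u N ^ 2.
Proof.
intros H. destruct N as [|N]; [simpl; unfold PS_mult; simpl; lra|].
replace (sum_f_R0 u (S N) ^ 2) with (sum_f_R0 u (S N) * sum_f_R0 u (S N)) by ring.
rewrite cauchy_finite by lia.
match goal with |- _ <= _ + ?r => assert (0 <= r) end.
{ apply cond_pos_sum. intros k. apply cond_pos_sum. intros l. now apply Rmult_le_pos. }
unfold PS_mult. lra.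
Qed.

Definition psum (a : R) (N : nat) (x : R) : R :=
  sum_f_R0 (fun j => coef a j * x ^ S j) N.

Lemma psum_weighted (a x : R) (N : nat) : 1 <= a ->
  sum_f_R0 (fun j => (2 + INR j / a) * (coef a j * x ^ S j)) (S N)
  = 2 * x + sum_f_R0 (fun m => PS_mult (coef a) (coef a) m * x ^ S (S m)) N.
Proof.
intros Ha. rewrite decomp_sum by lia. cbn [Init.Nat.pred].
f_equal; [rewrite coef_0; simpl; field; lra|].
apply sum_eq. intros i Hi. rewrite <- coef_S by easy. ring.
Qed.

Lemma psum_term_ge0 (a x : R) (j : nat) : 1 <= a -> 0 <= x -> 0 <= coef a j * x ^ S j.
Proof. intros. apply Rmult_le_pos; [now apply coef_ge0 | now apply pow_le]. Qed.

Lemma psum_weighted_le (a x : R) (N : nat) : 1 <= a -> 0 <= x ->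
  sum_f_R0 (fun j => (2 + INR j / a) * (coef a j * x ^ S j)) (S N)
  <= 2 * x + psum a N x ^ 2.
Proof.
intros Ha Hx. rewrite psum_weighted by easy. apply Rplus_le_compat_l.
unfold psum. etransitivity; [|apply sum_PS_mult_le; intros; now apply psum_term_ge0].
apply Req_le, sum_eq. intros i _.
rewrite <- (Rmult_1_l (_ * _)), <- (Rmult_1_l (1 * _)), <- PS_mult_geom.
apply PS_mult_ext_le. intros; apply Rmult_1_l.
Qed.

Lemma psum_ge0 (a x : R) (N : nat) : 1 <= a -> 0 <= x -> 0 <= psum a N x.
Proof. intros. apply cond_pos_sum. intros; now apply psum_term_ge0. Qed.

(** Induction through 2 S_(N+1) <= 2 x + S_N^2: the bound 1 reproduces itself at x = 1/2, where 2 S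
    = 2 x + S^2 has the double root S = 1. *)
Lemma psum_half (a : R) (N : nat) : 1 <= a -> psum a N (1/2) <= 1.
Proof.
intros Ha. induction N as [|N IH].
- unfold psum; simpl; rewrite coef_0; lra.
- assert (0 <= psum a N (1/2)) by (apply psum_ge0; lra).
  pose proof (psum_weighted_le a (1/2) N Ha ltac:(lra)) as H1.
  assert (2 * psum a (S N) (1/2) <= sum_f_R0 (fun j => (2 + INR j / a) * (coef a j * (1/2) ^ S j)) (S N)).
  { unfold psum. rewrite scal_sum. apply sum_Rle. intros j _.
    rewrite Rmult_comm. apply Rmult_le_compat_r; [apply psum_term_ge0; lra|].
    assert (0 <= INR j / a) by (apply Rdiv_le_0_compat; [apply pos_INR|lra]). lra. }
  assert (psum a N (1/2) ^ 2 <= 1) by nra. lra.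
Qed.

Lemma pow_diff_le (x y : R) (j : nat) : 0 <= y <= x ->
  x ^ S j - y ^ S j <= INR (S j) * x ^ j * (x - y).
Proof.
intros [Hy Hxy]. induction j as [|j IH]; [simpl; lra|].
assert (0 <= x ^ j) by (apply pow_le; lra).
assert (y ^ S j <= x ^ S j) by (apply pow_incr; lra).
rewrite S_INR. change (x ^ S (S j)) with (x * x ^ S j).
change (y ^ S (S j)) with (y * y ^ S j).
replace (x * x ^ S j - y * y ^ S j) with (x * (x ^ S j - y ^ S j) + (x - y) * y ^ S j) by ring.
assert (x * (x ^ S j - y ^ S j) <= x * (INR (S j) * x ^ j * (x - y))) by (apply Rmult_le_compat_l; lra).
assert ((x-y) * y ^ S j <= (x - y) * x ^ S j) by (apply Rmult_le_compat_l; lra).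
simpl (x ^ S j) in *. nra.
Qed.

(** The recursion bounds [x S_N'(x)] by [a (2 x + S_(N-1)(x)^2)], so the partial
    sums cannot grow fast to the right of [g], uniformly in [N]. *)
Lemma psum_extend (a g mu mu' : R) : 1 <= a -> 0 < g -> mu < mu' ->
  (forall N, psum a N g <= mu) ->
  exists x, g < x /\ forall N, psum a N x <= mu'.
Proof.
intros Ha Hg Hmu Hb.
assert (Hmu0 : 0 <= mu) by (generalize (Hb O), (psum_ge0 a g O Ha (Rlt_le _ _ Hg)); lra).
(* As long as the previous partial sum is at most [mu'] at [x], the next one grows from [g] to [x]
   by at most [(x - g) * K]. The step [eta] spends exactly the margin [mu' - mu]. *)
set (K := a * (2 + mu' ^ 2 / g)).
assert (HK : 2 <= K).
{ assert (0 <= mu' ^ 2 / g) by (apply Rdiv_le_0_compat; nra). unfold K. nra. }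
set (eta := (mu' - mu) / K).
assert (Heta : 0 < eta) by (apply Rdiv_lt_0_compat; lra).
assert (HetaK : eta * K = mu' - mu) by (unfold eta; field; lra).
exists (g + eta). split; [lra|]. set (x := g + eta).
assert (Hx : g < x) by (unfold x; lra).
induction N as [|N IH].
- generalize (Hb O). unfold psum; simpl. rewrite coef_0. unfold x. nra.
- assert (H0 : 0 <= psum a N x) by (apply psum_ge0; lra).
  pose proof (psum_weighted_le a x N Ha ltac:(lra)) as H1.
  assert (H2 : psum a (S N) x - psum a (S N) g <=
     eta / x * a * sum_f_R0 (fun j => (2 + INR j / a) * (coef a j * x ^ S j)) (S N)).
  { unfold psum. rewrite <- minus_sum, scal_sum. apply sum_Rle. intros j _.
    pose proof (pow_diff_le x g j ltac:(lra)) as H3.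
    pose proof (coef_ge0 a j Ha) as H4.
    replace (x - g) with eta in H3 by (unfold x; ring).
    assert (H5 : coef a j * (x ^ S j - g ^ S j) <= coef a j * (INR (S j) * x ^ j * eta))
     by (now apply Rmult_le_compat_l).
    rewrite <- Rmult_minus_distr_l. etransitivity; [exact H5|].
    replace ((2 + INR j / a) * (coef a j * x ^ S j) * (eta / x * a))
      with (coef a j * ((2 * a + INR j) * x ^ j * eta)) by (simpl; field; lra).
    apply Rmult_le_compat_l; [easy|]. apply Rmult_le_compat_r; [lra|].
    apply Rmult_le_compat_r; [apply pow_le; lra|]. rewrite S_INR. lra. }
  assert (H3 : eta / x * a * sum_f_R0 (fun j => (2 + INR j / a) * (coef a j * x ^ S j)) (S N)
      <= eta / x * a * (2 * x + mu' ^ 2)).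
  { apply Rmult_le_compat_l.
    - apply Rmult_le_pos; [apply Rdiv_le_0_compat; lra|lra].
    - etransitivity; [exact H1|]. assert (psum a N x ^ 2 <= mu' ^ 2) by (apply pow_incr; lra). lra. }
  assert (H4 : eta / x * a * (2 * x + mu' ^ 2) <= eta * K).
  { replace (eta / x * a * (2 * x + mu' ^ 2)) with (eta * (a * (2 + mu' ^ 2 / x))) by (field; lra).
    apply Rmult_le_compat_l; [lra|]. apply Rmult_le_compat_l; [lra|]. apply Rplus_le_compat_l.
    apply Rmult_le_compat_l; [apply pow2_ge_0|]. apply Rinv_le_contravar; lra. }
  generalize (Hb (S N)). lra.
Qed.

Lemma psum_continuous (a : R) (N : nat) (x : R) : continuous (psum a N) x.
Proof.
unfold psum. induction N as [|N IH]; simpl.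
- apply (ex_derive_continuous (fun x => coef a 0 * (x * 1))). auto_derive; easy.
- apply (continuous_plus (fun x => sum_f_R0 (fun j => coef a j * (x * x ^ j)) N)
     (fun x => coef a (S N) * (x * (x * x ^ N)))); [exact IH|].
  apply (ex_derive_continuous (fun x => coef a (S N) * (x * (x * x ^ N)))). auto_derive; easy.
Qed.

Lemma psum_S (a : R) (N : nat) (x : R) : 1 <= a -> 0 <= x -> psum a N x <= psum a (S N) x.
Proof.
intros. unfold psum; simpl. generalize (psum_term_ge0 a x (S N)); simpl. lra.
Qed.

(** [g] is the supremum of the points where every partial sum is at most 1. Continuity of each
    partial sum keeps the bound at [g], and a limit below 1 would let [psum_extend] go past the
    supremum. *)
Lemma critical_point_exists (a : R) : 1 <= a ->
  exists g, 0 < g /\ is_lim_seq (fun N => psum a N g) 1.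
Proof.
intros Ha.
set (E := fun x => 0 <= x /\ forall N, psum a N x <= 1).
assert (Hhalf : E (1/2)) by (split; [lra|intros; now apply psum_half]).
destruct (completeness E) as [g [Hub Hlub]].
{ exists 1. intros x [Hx0 Hx]. specialize (Hx O). unfold psum in Hx; simpl in Hx.
  rewrite coef_0 in Hx. lra. }
{ now exists (1/2). }
assert (Hg : 1/2 <= g) by now apply Hub.
exists g. split; [lra|].
assert (Hle : forall N, psum a N g <= 1).
{ intros N. apply Rnot_lt_le. intros Hlt.
  destruct (proj1 (continuity_pt_locally _ _)
     (proj2 (continuity_pt_filterlim _ _) (psum_continuous a N g))
     (mkposreal (psum a N g - 1) ltac:(lra))) as [d Hd].
  simpl in Hd.
  assert (g <= g - d / 2); [|generalize (cond_pos d); lra].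
  apply Hlub. intros x [Hx0 Hx]. apply Rnot_lt_le. intros Hlt2.
  assert (x <= g) by (now apply Hub).
  assert (Hb : ball g d x).
  { change (Rabs (x - g) < d). apply Rabs_lt_between. generalize (cond_pos d). lra. }
  specialize (Hd x Hb). specialize (Hx N). apply Rabs_lt_between in Hd. lra. }
assert (Hincr : forall N, psum a N g <= psum a (S N) g) by (intros; apply psum_S; lra).
destruct (ex_finite_lim_seq_incr _ 1 Hincr Hle) as [l Hl].
assert (Hl1 : l <= 1).
{ apply (is_lim_seq_le _ (fun _ => 1) l 1 Hle Hl (is_lim_seq_const 1)). }
destruct (Rle_lt_or_eq_dec _ _ Hl1) as [Hlt|<-]; [|exact Hl].
destruct (psum_extend a g l 1 Ha ltac:(lra) Hlt) as [x [Hgx Hx]].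
{ intros N. apply (is_lim_seq_incr_compare _ _ Hl Hincr). }
assert (x <= g); [apply Hub; split; [lra|easy]|lra].
Qed.

(** The partial sums stay bounded at some point beyond [g]. Strict inequality is what permits
    differentiating the series at [g]. *)
Lemma coef_radius (a g : R) : 1 <= a -> 0 < g -> is_lim_seq (fun N => psum a N g) 1 ->
  Rbar_lt g (CV_radius (coef a)).
Proof.
intros Ha Hg Hl.
destruct (psum_extend a g 1 2 Ha Hg ltac:(lra)) as [x [Hgx Hx]].
{ intros N. apply (is_lim_seq_incr_compare _ _ Hl). intros; apply psum_S; lra. }
apply Rbar_lt_le_trans with (Finite x); [exact Hgx|].
apply CV_radius_bounded. exists (2 / x). intros n.
assert (H0 : 0 <= coef a n * x ^ n) by (apply Rmult_le_pos; [now apply coef_ge0|apply pow_le; lra]).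
rewrite Rabs_pos_eq by easy.
apply (Rmult_le_reg_r x); [lra|]. replace (2 / x * x) with 2 by (field; lra).
apply Rle_trans with (2 := Hx n).
destruct n as [|n]; unfold psum; simpl; [lra|].
assert (0 <= psum a n x) by (apply psum_ge0; lra). unfold psum in *; simpl in *. lra.
Qed.

(** * The Riccati equation of the generating function *)

Definition genf (a : R) : nat -> R := PS_incr_1 (coef a).

(** The operator y d/dy on coefficients. Its iterates applied to [genf] and evaluated at [g] give
    the successive moments, up to the factor m_0. *)
Definition euler (u : nat -> R) (k : nat) : R := INR k * u k.

Lemma euler_PS_derive (u : nat -> R) (k : nat) : euler u k = PS_incr_1 (PS_derive u) k.
Proof.
destruct k; unfold euler, PS_incr_1, PS_derive; [simpl; unfold zero; simpl; ring|reflexivity].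
Qed.

Lemma CV_radius_euler (u : nat -> R) : CV_radius (euler u) = CV_radius u.
Proof.
rewrite (CV_radius_ext _ (PS_incr_1 (PS_derive u))) by apply euler_PS_derive.
now rewrite CV_radius_incr_1, CV_radius_derive.
Qed.

Lemma PSeries_euler (u : nat -> R) (x : R) :
  PSeries (euler u) x = x * PSeries (PS_derive u) x.
Proof.
rewrite (PSeries_ext _ (PS_incr_1 (PS_derive u))) by apply euler_PS_derive.
now rewrite PSeries_incr_1.
Qed.

Lemma genf_relation (a : R) (k : nat) : 1 <= a ->
  PS_plus (PS_scal 2 (coef a)) (PS_scal (1 / a) (euler (coef a))) k
  = PS_plus (fun j => match j with O => 2 | S _ => 0 end)
      (PS_incr_1 (PS_mult (coef a) (coef a))) k.
Proof.
intros Ha. unfold PS_plus, PS_scal, PS_incr_1, euler, plus, scal, zero; simpl; unfold mult; simpl.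
destruct k as [|k].
- rewrite coef_0. simpl. ring.
- rewrite <- coef_S by easy. field. lra.
Qed.

Lemma coef_ode (a y : R) : 1 <= a -> Rbar_lt (Rabs y) (CV_radius (coef a)) ->
  2 * PSeries (coef a) y + 1 / a * PSeries (euler (coef a)) y
  = 2 + y * PSeries (coef a) y ^ 2.
Proof.
intros Ha Hy.
assert (Hc : ex_pseries (coef a) y) by now apply CV_radius_inside.
assert (He : ex_pseries (euler (coef a)) y) by (apply CV_radius_inside; now rewrite CV_radius_euler).
rewrite <- !PSeries_scal, <- PSeries_plus
  by (apply ex_pseries_scal; [apply Rmult_comm | easy]).
rewrite (PSeries_ext _ _ y (fun k => genf_relation a k Ha)).
assert (Hconst : is_pseries (fun j => match j with O => 2 | S _ => 0 end) y 2).
{ apply is_pseries_R. apply is_series_decr_1.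
  replace (plus 2 (opp _)) with 0 by (unfold plus, opp; simpl; ring).
  apply is_series_ext with (fun _ => 0); [intros; simpl; ring|].
  apply is_series_Reals. intros e He2. exists O. intros n _. unfold Rdist.
  rewrite sum_eq_R0 by easy. rewrite Rminus_0_r, Rabs_R0. easy. }
rewrite PSeries_plus.
- rewrite (is_pseries_unique _ _ _ Hconst), PSeries_incr_1, PSeries_mult by easy. ring.
- now exists 2.
- apply ex_pseries_incr_1. apply ex_pseries_mult; easy.
Qed.

Lemma genf_radius (a : R) : CV_radius (genf a) = CV_radius (coef a).
Proof. apply CV_radius_incr_1. Qed.

(** Writing B = y P, the term y B' = y (y P' + P) produces an extra B, which lowers the coefficient
    2 in the equation for P to [2 - 1 / a]. *)
Lemma genf_ode (a y : R) : 1 <= a -> Rbar_lt (Rabs y) (CV_radius (coef a)) ->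
  (2 - 1 / a) * PSeries (genf a) y + 1 / a * PSeries (euler (genf a)) y
  = 2 * y + PSeries (genf a) y ^ 2.
Proof.
intros Ha Hy.
assert (He : PSeries (euler (genf a)) y
  = y * (PSeries (euler (coef a)) y + PSeries (coef a) y)).
{ rewrite <- PSeries_plus, <- PSeries_incr_1.
  - apply PSeries_ext. intros [|k]; unfold euler, genf, PS_incr_1, PS_plus, plus, zero.
    + simpl; ring.
    + rewrite S_INR. simpl. ring.
  - apply CV_radius_inside. now rewrite CV_radius_euler.
  - now apply CV_radius_inside. }
rewrite He. unfold genf. rewrite PSeries_incr_1.
pose proof (coef_ode a y Ha Hy) as H.
set (P := PSeries (coef a) y) in *. set (Q := PSeries (euler (coef a)) y) in *.
replace ((2 - 1 / a) * (y * P) + 1 / a * (y * (Q + P))) with (y * (2 * P + 1 / a * Q)) by ring.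
rewrite H. ring.
Qed.

Lemma genf_euler_ode (a y : R) : 1 <= a -> Rbar_lt (Rabs y) (CV_radius (coef a)) ->
  (2 - 1 / a) * PSeries (euler (genf a)) y + 1 / a * PSeries (euler (euler (genf a))) y
  = 2 * y + 2 * PSeries (genf a) y * PSeries (euler (genf a)) y.
Proof.
intros Ha Hy.
rewrite (PSeries_euler (euler (genf a))), (PSeries_euler (genf a)).
assert (HB : is_derive (PSeries (genf a)) y (PSeries (PS_derive (genf a)) y)).
{ apply is_derive_PSeries. now rewrite genf_radius. }
assert (HE : is_derive (PSeries (euler (genf a))) y (PSeries (PS_derive (euler (genf a))) y)).
{ apply is_derive_PSeries. now rewrite CV_radius_euler, genf_radius. }
assert (H : (2 - 1 / a) * PSeries (PS_derive (genf a)) y + 1 / a * PSeries (PS_derive (euler (genf a))) y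
  = 2 + 2 * PSeries (genf a) y * PSeries (PS_derive (genf a)) y).
{ transitivity (Derive (fun x => (2 - 1 / a) * PSeries (genf a) x + 1 / a * PSeries (euler (genf a)) x) y).
  - symmetry. apply is_derive_unique. 
    apply (is_derive_plus (fun x => (2 - 1/a) * PSeries (genf a) x) (fun x => 1 / a * PSeries (euler (genf a)) x));
    apply is_derive_scal; assumption.
  - rewrite (Derive_ext_loc _ (fun x => 2 * x + PSeries (genf a) x ^ 2)).
    + apply is_derive_unique. auto_derive; [exists (PSeries (PS_derive (genf a)) y); exact HB|].
      match goal with |- context [Derive ?f y] => replace (Derive f y) with (PSeries (PS_derive (genf a)) y) by (symmetry; exact (is_derive_unique _ _ _ HB)) end. ring.
    (* Equality at [y] alone says nothing about derivatives; the equation holds near [y] because the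
       disk of convergence is open. *)
    + assert (Hopen : locally y (fun x => Rbar_lt (Rabs x) (CV_radius (coef a)))).
      { apply (open_comp Rabs (fun u : R => Rbar_lt (Finite u) (CV_radius (coef a)))).
        - intros x _. apply continuous_Rabs.
        - apply open_Rbar_lt.
        - exact Hy. }
      revert Hopen. apply filter_imp. intros x Hx. now apply genf_ode. }
replace ((2 - 1 / a) * (y * PSeries (PS_derive (genf a)) y) + 1 / a * (y * PSeries (PS_derive (euler (genf a))) y))
 with (y * ((2 - 1 / a) * PSeries (PS_derive (genf a)) y + 1 / a * PSeries (PS_derive (euler (genf a))) y)) by ring.
rewrite H. ring.
Qed.

(** * Moments, existence and uniqueness of solutions *)

Lemma is_series_PSeries_shift (u : nat -> R) (x : R) :
  u O = 0 -> Rbar_lt (Rabs x) (CV_radius u) ->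
  is_series (fun j => u (S j) * x ^ S j) (PSeries u x).
Proof.
intros H0 Hx. apply (is_series_incr_1 (fun j => u j * x ^ j)).
rewrite H0, Rmult_0_l. unfold plus; simpl. rewrite Rplus_0_r.
apply is_pseries_R, PSeries_correct. now apply CV_radius_inside.
Qed.

Lemma is_series_Rmult_l (m : R) (u v : nat -> R) (l : R) :
  (forall j, v j = m * u j) -> is_series u l -> is_series v (m * l).
Proof.
intros Huv Hu. apply (is_series_ext (fun j => m * u j)); [now intros; rewrite Huv|].
exact (is_series_scal_l m u l Hu).
Qed.

Lemma moment_shift (i : nat) (c : nat -> R) :
  moment i c = Lim_seq (sum_n (fun j => INR (S j) ^ i * c (S j))).
Proof.
unfold moment. rewrite <- Lim_seq_incr_1. apply Lim_seq_ext. intros N.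
rewrite <- sum_n_m_S. reflexivity.
Qed.

Lemma moment_is_series (i : nat) (c : nat -> R) (l : R) :
  is_series (fun j => INR (S j) ^ i * c (S j)) l -> moment i c = Finite l.
Proof. intros H. rewrite moment_shift. apply is_lim_seq_unique, H. Qed.

Lemma is_series_moment (i : nat) (c : nat -> R) (l : R) :
  (forall k, (1 <= k)%nat -> 0 <= c k) -> moment i c = Finite l ->
  is_series (fun j => INR (S j) ^ i * c (S j)) l.
Proof.
intros Hc H. rewrite moment_shift in H.
change (is_lim_seq (sum_n (fun j => INR (S j) ^ i * c (S j))) l).
rewrite <- H. apply Lim_seq_correct, ex_lim_seq_incr. intros n.
rewrite sum_Sn. unfold plus; cbn -[INR pow].
assert (0 <= INR (S (S n)) ^ i * c (S (S n))); [|lra].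
apply Rmult_le_pos; [apply pow_le, pos_INR|apply Hc; lia].
Qed.

Lemma psum_is_series (a g l : R) :
  is_lim_seq (fun N => psum a N g) l <-> is_series (fun j => coef a j * g ^ S j) l.
Proof.
split; intros H.
- change (is_lim_seq (sum_n (fun j => coef a j * g ^ S j)) l).
  eapply is_lim_seq_ext; [|exact H]. intros n. symmetry. apply sum_n_Reals.
- eapply is_lim_seq_ext; [|exact H]. intros n. apply sum_n_Reals.
Qed.

(** The linear term alone contributes [h - g] and the others are nondecreasing. Being uniform in
    [N], the gap survives in the limit and makes the root of B = 1 unique. *)
Lemma psum_gap (a g h : R) (N : nat) : 1 <= a -> 0 <= g <= h ->
  h - g <= psum a N h - psum a N g.
Proof.
intros Ha Hgh. induction N as [|N IH]; [unfold psum; simpl; rewrite coef_0; lra|].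
unfold psum in *; simpl in *.
assert (coef a (S N) * (g * (g * g ^ N)) <= coef a (S N) * (h * (h * h ^ N))); [|lra].
apply Rmult_le_compat_l; [now apply coef_ge0|]. apply (pow_incr g h (S (S N))). lra.
Qed.

Lemma psum_root_unique_le (a g h : R) : 1 <= a -> 0 <= g -> 0 <= h ->
  is_lim_seq (fun N => psum a N g) 1 -> is_lim_seq (fun N => psum a N h) 1 -> h <= g.
Proof.
intros Ha Hg Hh Lg Lh. apply Rnot_lt_le. intros Hlt.
assert (Hgap : forall N, h - g <= psum a N h - psum a N g) by (intros; apply psum_gap; lra).
pose proof (is_lim_seq_le _ _ (h - g) (1 - 1) Hgap (is_lim_seq_const _)
  (is_lim_seq_minus' _ _ _ _ Lh Lg)) as H. simpl in H. lra.
Qed.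

Lemma psum_root_unique (a g h : R) : 1 <= a -> 0 <= g -> 0 <= h ->
  is_lim_seq (fun N => psum a N g) 1 -> is_lim_seq (fun N => psum a N h) 1 -> h = g.
Proof. intros. apply Rle_antisym; eapply psum_root_unique_le; eauto. Qed.

Lemma convolution_shift (d : nat -> R) (p : nat) :
  sum_n_m (fun i => d i * d (S (S p) - i)%nat) 1 (S (S p) - 1)
  = PS_mult (fun i => d (S i)) (fun i => d (S i)) p.
Proof.
replace (S (S p) - 1)%nat with (S p) by lia. rewrite <- sum_n_m_S.
change (sum_n (fun n => d (S n) * d (S (S p) - S n)%nat) p
  = PS_mult (fun i => d (S i)) (fun i => d (S i)) p).
rewrite sum_n_Reals. apply sum_eq. intros i Hi. now replace (S (S p) - S i)%nat with (S (p - i)) by lia.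
Qed.

(** The first moment dominates the mass, which gives convergence; a mass of zero would make every
    term vanish, against first moment 1. *)
Lemma solution_mass (n : nat) (d : nat -> R) : solves n d ->
  exists m, 0 < m /\ moment 0 d = Finite m /\ is_series (fun j => d (S j)) m.
Proof.
intros [Hd [H1 _]].
pose proof (is_series_moment 1 d 1 Hd H1) as S1.
assert (Hex : ex_series (fun j => d (S j))).
{ apply (ex_series_le (V := R_CompleteNormedModule) _ (fun j => INR (S j) ^ 1 * d (S j))); [|now exists 1].
  intros j. unfold norm; simpl norm; unfold abs; simpl abs. rewrite Rabs_pos_eq by (apply Hd; lia).
  rewrite <- (Rmult_1_l (d (S j))) at 1. apply Rmult_le_compat_r; [apply Hd; lia|].
  rewrite pow_1, S_INR. generalize (pos_INR j); lra. }
destruct Hex as [m Hm]. exists m.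
assert (Hm0 : moment 0 d = Finite m).
{ apply moment_is_series. eapply is_series_ext; [|exact Hm]. intros; simpl; ring. }
assert (Hincr : forall N, sum_n (fun j => d (S j)) N <= sum_n (fun j => d (S j)) (S N)).
{ intros N. rewrite sum_Sn. unfold plus; simpl. generalize (Hd (S (S N)) ltac:(lia)); lra. }
assert (Hle : forall j, d (S j) <= m).
{ intros j. apply Rle_trans with (2 := is_lim_seq_incr_compare _ _ Hm Hincr j).
  destruct j as [|j]; [rewrite sum_O; lra|]. rewrite sum_Sn, sum_n_Reals. unfold plus; simpl.
  assert (0 <= sum_f_R0 (fun j => d (S j)) j); [|lra].
  apply cond_pos_sum. intros; apply Hd; lia. }
split; [|now split].
apply Rnot_le_lt. intros Hneg.
assert (Hz : forall j, INR (S j) ^ 1 * d (S j) = 0).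
{ intros j. assert (d (S j) = 0); [|nra]. generalize (Hle j), (Hd (S j) ltac:(lia)). lra. }
assert (1 = 0); [|lra].
rewrite <- (is_series_unique _ _ S1), (Series_ext _ _ Hz).
apply is_series_unique. apply is_series_Reals. intros e He. exists O. intros k _. unfold Rdist.
rewrite sum_eq_R0 by easy. now rewrite Rminus_0_r, Rabs_R0.
Qed.

(** With h = d_1 / m_0 the recursion fixes all later terms as rescaled coefficients. Dividing the
    total mass by m_0 then says B(h) = 1, so h is [g]. *)
Lemma solution_form (n : nat) (d : nat -> R) : (1 <= n)%nat -> solves n d ->
  forall g, 0 < g -> is_lim_seq (fun N => psum (INR n) N g) 1 ->
  exists m, 0 < m /\ forall j, d (S j) = m * (coef (INR n) j * g ^ S j).
Proof.
intros Hn Hsol g Hg Lg.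
assert (Ha : 1 <= INR n) by (apply (le_INR 1); lia).
destruct (solution_mass n d Hsol) as [m [Hm [Hm0 Sm]]].
destruct Hsol as [Hd [_ Hrec]].
set (h := d 1%nat / m).
assert (Hh : 0 <= h) by (apply Rdiv_le_0_compat; [apply Hd; lia|lra]).
assert (Hform : forall j, d (S j) = m * (coef (INR n) j * h ^ S j)).
{ induction j as [j IH] using lt_wf_ind. destruct j as [|p].
  - rewrite coef_0. unfold h. simpl. field. lra.
  - specialize (Hrec (S (S p)) ltac:(lia)). rewrite convolution_shift, Hm0 in Hrec.
    simpl real in Hrec.
    rewrite (PS_mult_ext_le _ (fun i => m * (coef (INR n) i * h ^ S i))) in Hrec
      by (intros; apply IH; lia).
    rewrite PS_mult_geom, <- coef_S in Hrec by easy.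
    pose proof (weight_pos (INR n) (S p) Ha) as Hw.
    replace (INR (S (S p)) - 1) with (INR (S p)) in Hrec by (rewrite (S_INR (S p)); ring).
    apply (Rmult_eq_reg_l (2 + INR (S p) / INR n)); [|lra]. rewrite Hrec.
    set (w := 2 + INR (S p) / INR n) in *. field. lra. }
assert (Lh : is_lim_seq (fun N => psum (INR n) N h) 1).
{ apply psum_is_series. replace 1 with (/ m * m) by (field; lra).
  apply (is_series_Rmult_l _ _ _ _) with (2 := Sm).
  intros j. rewrite Hform. field. lra. }
rewrite (psum_root_unique (INR n) g h Ha ltac:(lra) Hh Lg Lh) in Hform.
now exists m.
Qed.

Section Critical.
Context (a g : R) (Ha : 1 <= a) (Hg : 0 < g) (Lg : is_lim_seq (fun N => psum a N g) 1).

Lemma critical_in_disk : Rbar_lt (Rabs g) (CV_radius (coef a)).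
Proof. rewrite Rabs_pos_eq by lra. now apply coef_radius. Qed.

Lemma genf_critical : PSeries (genf a) g = 1.
Proof.
rewrite <- (is_series_unique _ _ (proj1 (psum_is_series a g 1) Lg)). symmetry.
apply is_series_unique. apply (is_series_PSeries_shift (genf a)); [reflexivity|].
rewrite genf_radius. apply critical_in_disk.
Qed.

Lemma euler_genf_critical : PSeries (euler (genf a)) g = 1 + a * (2 * g - 1).
Proof.
pose proof (genf_ode a g Ha critical_in_disk) as H. rewrite genf_critical in H.
apply (Rmult_eq_reg_l (1 / a)); [|apply Rgt_not_eq, Rdiv_lt_0_compat; lra].
replace (1 / a * (1 + a * (2 * g - 1))) with (1 / a + (2 * g - 1)) by (field; lra). lra.
Qed.

Lemma euler2_genf_critical :
  PSeries (euler (euler (genf a))) g = 2 * a * g + (1 + a * (2 * g - 1)).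
Proof.
pose proof (genf_euler_ode a g Ha critical_in_disk) as H.
rewrite genf_critical, euler_genf_critical in H.
apply (Rmult_eq_reg_l (1 / a)); [|apply Rgt_not_eq, Rdiv_lt_0_compat; lra].
match goal with |- ?l = _ => assert (He : l = 2 * g + 2 * 1 * (1 + a * (2 * g - 1)) - (2 - 1 / a) * (1 + a * (2 * g - 1))) by lra end.
rewrite He. field. lra.
Qed.

(** The weights k >= 1 give g B'(g) >= B(g) = 1, while the left side equals
    [1 + a * (2 * g - 1)]. *)
Lemma critical_ge_half : 1 / 2 <= g.
Proof.
assert (H : 1 <= PSeries (euler (genf a)) g).
{ apply (is_lim_seq_le (fun N => psum a N g) (sum_n (fun j => euler (genf a) (S j) * g ^ S j)) 1 (PSeries (euler (genf a)) g)).
  - intros N. rewrite sum_n_Reals. apply sum_Rle. intros j _. unfold euler, genf, PS_incr_1.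
    rewrite Rmult_assoc. pose proof (psum_term_ge0 a g j Ha ltac:(lra)). rewrite S_INR.
    generalize (pos_INR j). nra.
  - exact Lg.
  - apply (is_series_PSeries_shift (euler (genf a))).
    + unfold euler; simpl; ring.
    + rewrite CV_radius_euler, genf_radius. apply critical_in_disk. }
rewrite euler_genf_critical in H. nra.
Qed.

Lemma critical_profile_moments (m : R) (c : nat -> R) :
  (forall j, c (S j) = m * (coef a j * g ^ S j)) ->
  moment 0 c = Finite m /\ moment 1 c = Finite (m * (1 + a * (2 * g - 1))) /\
  moment 2 c = Finite (m * (2 * a * g + (1 + a * (2 * g - 1)))).
Proof.
intros Hc. rewrite <- euler2_genf_critical, <- euler_genf_critical.
replace (Finite m) with (Finite (m * PSeries (genf a) g)) by (rewrite genf_critical; f_equal; ring).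
pose proof critical_in_disk as Hin.
split; [|split]; apply moment_is_series;
 (eapply is_series_Rmult_l; [|apply is_series_PSeries_shift]);
 try (intros j; rewrite Hc; unfold euler, genf, PS_incr_1; cbn -[INR]; ring);
 try (unfold euler; simpl; ring); try easy;
 now rewrite ?CV_radius_euler, genf_radius.
Qed.
End Critical.

Lemma solution_exists (n : nat) : (1 <= n)%nat -> exists c, solves n c.
Proof.
intros Hn. assert (Ha : 1 <= INR n) by (apply (le_INR 1); lia).
destruct (critical_point_exists (INR n) Ha) as [g [Hg Lg]].
set (a := INR n) in *.
pose proof (critical_ge_half a g Ha Hg Lg) as Hhalf.
assert (HE : 0 < 1 + a * (2 * g - 1)) by nra.
(* The mass that normalises the first moment to 1. *)
set (m := / (1 + a * (2 * g - 1))).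
assert (Hm : 0 < m) by now apply Rinv_0_lt_compat.
set (c := fun k => m * (coef a (k - 1) * g ^ k)).
assert (Hc : forall j, c (S j) = m * (coef a j * g ^ S j)).
{ intros j. unfold c. now replace (S j - 1)%nat with j by lia. }
destruct (critical_profile_moments a g Ha Hg Lg m c Hc) as [M0 [M1 _]].
exists c. split; [|split].
- intros [|j] Hj; [lia|]. rewrite Hc. apply Rmult_le_pos; [lra|]. apply psum_term_ge0; lra.
- rewrite M1. f_equal. unfold m. field. lra.
- intros [|[|p]] Hk; [lia|lia|]. rewrite convolution_shift, M0. simpl real.
  rewrite (PS_mult_ext_le _ (fun i => m * (coef a i * g ^ S i))) by (intros; apply Hc).
  rewrite PS_mult_geom, <- coef_S, Hc by easy.
  replace (INR (S (S p)) - 1) with (INR (S p)) by (rewrite (S_INR (S p)); ring).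
  fold a. pose proof (weight_pos a (S p) Ha) as Hw. set (w := 2 + INR (S p) / a) in *. field. lra.
Qed.

Lemma solution_moments (n : nat) (d : nat -> R) (g : R) : (1 <= n)%nat -> solves n d ->
  0 < g -> is_lim_seq (fun N => psum (INR n) N g) 1 ->
  (forall j, d (S j) = / (1 + INR n * (2 * g - 1)) * (coef (INR n) j * g ^ S j)) /\
  moment 0 d = Finite (/ (1 + INR n * (2 * g - 1))) /\
  moment 2 d = Finite (1 + 2 * INR n * g / (1 + INR n * (2 * g - 1))).
Proof.
intros Hn Hsol Hg Lg. assert (Ha : 1 <= INR n) by (apply (le_INR 1); lia).
destruct (solution_form n d Hn Hsol g Hg Lg) as [m [Hm Hd]].
destruct (critical_profile_moments (INR n) g Ha Hg Lg m d Hd) as [M0 [M1 M2]].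
destruct Hsol as [_ [H1 _]]. rewrite H1 in M1. injection M1 as M1.
pose proof (critical_ge_half _ g Ha Hg Lg) as Hhalf.
set (E := 1 + INR n * (2 * g - 1)) in *. assert (HE : 0 < E) by (unfold E; nra).
assert (m = / E) as -> by (apply (Rmult_eq_reg_r E); [rewrite <- M1; field; lra|lra]).
split; [easy|split; [easy|]]. rewrite M2. f_equal. field. lra.
Qed.

(** * The Airy function *)

(* [auto_derive] leaves eta-expanded [Derive (fun x => f x)], which [rewrite] misses. *)
Ltac derive_rewrite H :=
  match type of H with is_derive _ ?x ?l =>
    match goal with |- context [Derive ?g ?z] =>
      replace (Derive g z) with l by (symmetry; exact (is_derive_unique _ _ _ H))
    end
  end.

Lemma mean_value (f f' : R -> R) (a b : R) : a < b ->
  (forall x, a <= x <= b -> is_derive f x (f' x)) ->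
  exists c, a < c < b /\ f b - f a = f' c * (b - a).
Proof.
intros Hab Hf. destruct (MVT_cor2 f f' a b Hab) as [c [H1 H2]].
- intros c Hc. now apply is_derive_Reals, Hf.
- now exists c.
Qed.

Lemma derive_nonpos_decr (f f' : R -> R) (a b : R) : a <= b ->
  (forall x, a <= x <= b -> is_derive f x (f' x)) ->
  (forall x, a < x < b -> f' x <= 0) -> f b <= f a.
Proof.
intros Hab Hf Hn. destruct (Rle_lt_or_eq_dec _ _ Hab) as [Hlt| ->]; [|lra].
destruct (mean_value f f' a b Hlt Hf) as [c [Hc He]]. specialize (Hn c Hc). nra.
Qed.

(** Mean value inequality with a majorant: tails of oscillating integrals are later bounded through
    explicit primitives such as -1/t^2. *)
Lemma derive_abs_le (f f' g g' : R -> R) (a b : R) : a <= b ->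
  (forall x, a <= x <= b -> is_derive f x (f' x)) ->
  (forall x, a <= x <= b -> is_derive g x (g' x)) ->
  (forall x, a <= x <= b -> Rabs (f' x) <= g' x) ->
  Rabs (f b - f a) <= g b - g a.
Proof.
intros Hab Hf Hg Hle.
assert (H1 : f b - g b <= f a - g a).
{ apply (derive_nonpos_decr (fun x => f x - g x) (fun x => f' x - g' x) a b Hab).
  - intros x Hx. apply (is_derive_minus f g); auto.
  - intros x Hx. specialize (Hle x ltac:(lra)). apply Rabs_le_between in Hle. lra. }
assert (H2 : - f b - g b <= - f a - g a).
{ apply (derive_nonpos_decr (fun x => - f x - g x) (fun x => - f' x - g' x) a b Hab).
  - intros x Hx. apply (is_derive_minus (fun x => - f x) g); auto.
    apply (is_derive_opp f); auto.
  - intros x Hx. specialize (Hle x ltac:(lra)). apply Rabs_le_between in Hle. lra. }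
apply Rabs_le. lra.
Qed.

Lemma gronwall_nonneg (Z Z' : R -> R) (L x : R) : 0 <= x ->
  (forall y, 0 <= y <= x -> is_derive Z y (Z' y) /\ Z' y <= L * Z y) ->
  Z x <= Z 0 * exp (L * x).
Proof.
intros Hx H.
assert (H1 : Z x * exp (- (L * x)) <= Z 0 * exp (- (L * 0))).
{ apply (derive_nonpos_decr (fun y => Z y * exp (- (L * y)))
    (fun y => (Z' y - L * Z y) * exp (- (L * y))) 0 x Hx).
  - intros y Hy. destruct (H y Hy) as [Hd _]. auto_derive; [now exists (Z' y)|].
    derive_rewrite Hd. ring.
  - intros y Hy. destruct (H y ltac:(lra)) as [_ Hd]. pose proof (exp_pos (- (L * y))). nra. }
rewrite Rmult_0_r, Ropp_0, exp_0, Rmult_1_r, exp_Ropp in H1.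
apply (Rmult_le_reg_r (/ exp (L * x))); [apply Rinv_0_lt_compat, exp_pos|].
rewrite Rmult_assoc, Rinv_r; [lra|]. apply Rgt_not_eq, exp_pos.
Qed.

Lemma gronwall (Z Z' : R -> R) (L x : R) :
  (forall y, Rabs y <= Rabs x -> is_derive Z y (Z' y) /\ Rabs (Z' y) <= L * Z y) ->
  Z x <= Z 0 * exp (L * Rabs x).
Proof.
intros H. destruct (Rle_dec 0 x) as [Hx|Hx].
- rewrite Rabs_pos_eq in * by easy. apply (gronwall_nonneg Z Z'); [easy|].
  intros y Hy. destruct (H y) as [H1 H2]; [rewrite Rabs_pos_eq; lra|].
  split; [easy|]. apply Rabs_le_between in H2. lra.
- rewrite (Rabs_left x) in * by lra.
  replace (Z x) with ((fun y => Z (- y)) (- x)) by (simpl; f_equal; ring).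
  replace (Z 0) with ((fun y => Z (- y)) 0) by (simpl; f_equal; ring).
  apply (gronwall_nonneg (fun y => Z (- y)) (fun y => - Z' (- y))); [lra|].
  intros y Hy. destruct (H (- y)) as [H1 H2]; [rewrite Rabs_Ropp, Rabs_pos_eq; lra|].
  split.
  + replace (- Z' (- y)) with (scal (- 1) (Z' (- y))) by (unfold scal; simpl; unfold mult; simpl; ring).
    apply (is_derive_comp Z (fun y => - y)); [easy|]. auto_derive; [easy|ring].
  + apply Rabs_le_between in H2. lra.
Qed.

(** * Airy's equation y'' = x y and its power series solutions *)

Definition airy_pair (y y1 : R -> R) : Prop :=
  forall x, is_derive y x (y1 x) /\ is_derive y1 x (x * y x).

(** Comparing coefficients in y'' = x y gives (j+2) (j+3) c_(j+3) = c_j and c_2 = 0. *)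
Fixpoint airy_coef (c0 c1 : R) (k : nat) : R :=
  match k with
  | O => c0
  | S O => c1
  | S (S O) => 0
  | S (S (S j)) => airy_coef c0 c1 j / (INR (S (S j)) * INR (S (S (S j))))
  end.

(** Passing from index j to j+3 multiplies a term by r^3 / ((j+2) (j+3)), of absolute value at most
    1 once j exceeds |r|^3. So for every [r] the terms are bounded by the finitely many initial
    ones. *)
Lemma airy_coef_radius (c0 c1 : R) : CV_radius (airy_coef c0 c1) = p_infty.
Proof.
destruct (CV_radius_bounded (airy_coef c0 c1)) as [Hub _].
assert (H : forall r : R, Rbar_le r (CV_radius (airy_coef c0 c1))).
{ intros r. apply Hub.
  set (u := fun n => Rabs (airy_coef c0 c1 n * r ^ n)).
  destruct (nfloor_ex (Rabs r ^ 3)) as [K HK]; [apply pow_le, Rabs_pos|].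
  exists (sum_f_R0 u (S (S (S K)))). intros n. change (u n <= sum_f_R0 u (S (S (S K)))).
  induction n as [n IH] using lt_wf_ind.
  destruct (le_lt_dec n (S (S (S K)))) as [Hn|Hn].
  - clear -Hn. induction (S (S (S K))) as [|m IHm]; [now replace n with O by lia; right|].
    assert (H : forall p, 0 <= u p) by (intros; apply Rabs_pos). simpl.
    destruct (Nat.eq_dec n (S m)) as [->|Hne].
    + pose proof (cond_pos_sum u m H). lra.
    + specialize (IHm ltac:(lia)). specialize (H (S m)). lra.
  - destruct n as [|[|[|j]]]; try lia.
    apply Rle_trans with (u j); [|apply IH; lia].
    unfold u. cbn [airy_coef]. rewrite (pow_add r 3 j : r ^ S (S (S j)) = _).
    set (w := INR (S (S j)) * INR (S (S (S j)))).
    assert (Hw : Rabs r ^ 3 <= w).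
    { assert (INR K + 1 <= INR j) by (rewrite <- S_INR; apply le_INR; lia).
      unfold w. rewrite !S_INR. pose proof (pos_INR K). nra. }
    assert (0 < w) by (unfold w; apply Rmult_lt_0_compat; apply lt_0_INR; lia).
    replace (airy_coef c0 c1 j / w * (r ^ 3 * r ^ j)) with ((airy_coef c0 c1 j * r ^ j) * (r ^ 3 / w)) by (field; lra).
    rewrite Rabs_mult. rewrite <- (Rmult_1_r (Rabs (_ * r ^ j))) at 2.
    apply Rmult_le_compat_l; [apply Rabs_pos|].
    unfold Rdiv. rewrite Rabs_mult, <- RPow_abs, (Rabs_pos_eq (/ w)) by (left; now apply Rinv_0_lt_compat).
    apply (Rmult_le_reg_r w); [easy|]. rewrite Rmult_assoc, Rinv_l; lra. }
destruct (CV_radius (airy_coef c0 c1)) as [l| |]; [|easy|].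
- specialize (H (l + 1)). simpl in H. lra.
- now specialize (H 0).
Qed.

Lemma airy_ivp (c0 c1 : R) : exists y y1, airy_pair y y1 /\ y 0 = c0 /\ y1 0 = c1.
Proof.
set (u := airy_coef c0 c1).
assert (Hr : forall x : R, Rbar_lt (Rabs x) (CV_radius u)).
{ intros x. unfold u. now rewrite airy_coef_radius. }
exists (PSeries u), (PSeries (PS_derive u)). split; [intros x; split|split].
- now apply is_derive_PSeries.
- replace (x * PSeries u x) with (PSeries (PS_derive (PS_derive u)) x).
  + apply is_derive_PSeries. now rewrite CV_radius_derive.
  + rewrite <- PSeries_incr_1. apply PSeries_ext.
    intros [|j]; unfold PS_derive, PS_incr_1, u, zero; cbn [airy_coef].
    * simpl; ring.
    * field. split; apply not_0_INR; lia.
- apply PSeries_0.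
- rewrite PSeries_0. unfold PS_derive, u; simpl. ring.
Qed.

(** * The integral [Ai] as a solution of Airy's equation *)

Definition airy_phase (x t : R) : R := t ^ 3 / 3 + x * t.
Definition airy_trunc (T x : R) : R := RInt (fun t => cos (airy_phase x t)) 0 T.
Definition airy_trunc1 (T x : R) : R := RInt (fun t => - (t * sin (airy_phase x t))) 0 T.

Lemma is_derive_airy_trunc (T x : R) : is_derive (airy_trunc T) x (airy_trunc1 T x).
Proof.
assert (HD : forall z v, is_derive (fun u => cos (airy_phase u v)) z (- (v * sin (airy_phase z v)))).
{ intros z v. unfold airy_phase. auto_derive; [easy|]. simpl. ring. }
unfold airy_trunc1. rewrite <- (RInt_ext (fun t => Derive (fun u => cos (airy_phase u t)) x))
 by (intros t _; now apply is_derive_unique).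
apply (is_derive_RInt_param (fun u t => cos (airy_phase u t))).
- apply filter_forall. intros y t _. eexists. apply HD.
- intros t _. apply continuity_2d_pt_ext with (fun u v => - (v * sin (airy_phase u v))).
  { intros u v. symmetry. now apply is_derive_unique. }
  unfold airy_phase. apply continuity_2d_pt_opp, continuity_2d_pt_mult; [apply continuity_2d_pt_id2|].
  apply (continuity_1d_2d_pt_comp sin); [apply continuity_pt_filterlim, continuous_sin|].
  apply (continuity_2d_pt_plus (fun u v => v ^ 3 / 3) (fun u v => u * v)).
  + apply (continuity_1d_2d_pt_comp (fun v => v ^ 3 / 3) (fun u v => v)); [|apply continuity_2d_pt_id2].
    apply continuity_pt_filterlim, (ex_derive_continuous (fun v : R => v ^ 3 / 3)). auto_derive; easy.
  + apply continuity_2d_pt_mult; [apply continuity_2d_pt_id1|apply continuity_2d_pt_id2].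
- apply filter_forall. intros y. apply (ex_RInt_continuous (fun t => cos (airy_phase y t))). intros t _.
  apply (ex_derive_continuous (fun t => cos (airy_phase y t))). unfold airy_phase. auto_derive; easy.
Qed.

Lemma is_RInt_airy_phase (x T : R) :
  is_RInt (fun t => (t ^ 2 + x) * cos (airy_phase x t)) 0 T (sin (airy_phase x T)).
Proof.
replace (sin (airy_phase x T)) with (minus (sin (airy_phase x T)) (sin (airy_phase x 0))).
- apply (is_RInt_derive (fun t => sin (airy_phase x t))).
  + intros t _. unfold airy_phase. auto_derive; [easy|]. simpl. unfold Rdiv. field.
  + intros t _. apply (ex_derive_continuous (fun t => (t ^ 2 + x) * cos (airy_phase x t))).
    unfold airy_phase. auto_derive; easy.
- unfold minus, plus, opp; simpl. unfold airy_phase at 2.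
  replace (0 ^ 3 / 3 + x * 0) with 0 by field. rewrite sin_0. ring.
Qed.

Lemma ex_RInt_airy (x T : R) : ex_RInt (fun t => cos (airy_phase x t)) 0 T.
Proof.
apply (ex_RInt_continuous (fun t => cos (airy_phase x t))). intros t _.
apply (ex_derive_continuous (fun t => cos (airy_phase x t))). unfold airy_phase. auto_derive; easy.
Qed.

(** Differentiation yields minus the integral of t^2 cos, and (t^2 + x) cos is an exact derivative.
    The boundary term left at [T] keeps oscillating with amplitude 1 as [T] grows. *)
Lemma is_derive_airy_trunc1 (T x : R) :
  is_derive (airy_trunc1 T) x (x * airy_trunc T x - sin (airy_phase x T)).
Proof.
assert (HD : forall z v, is_derive (fun u => - (v * sin (airy_phase u v))) z (- (v ^ 2 * cos (airy_phase z v)))).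
{ intros z v. unfold airy_phase. auto_derive; [easy|]. simpl. ring. }
replace (x * airy_trunc T x - sin (airy_phase x T))
  with (RInt (fun t => Derive (fun u => - (t * sin (airy_phase u t))) x) 0 T).
2:{ rewrite (RInt_ext _ (fun t => - (t ^ 2 * cos (airy_phase x t))))
     by (intros t _; now apply is_derive_unique).
  apply is_RInt_unique.
  apply is_RInt_ext with (fun t => minus (scal x (cos (airy_phase x t))) ((t ^ 2 + x) * cos (airy_phase x t))).
  { intros t _. unfold minus, plus, opp, scal; simpl; unfold mult; simpl. ring. }
  apply (is_RInt_minus (fun t => scal x (cos (airy_phase x t))) (fun t => (t ^ 2 + x) * cos (airy_phase x t))).
  - apply (is_RInt_scal (fun t => cos (airy_phase x t))). apply (RInt_correct (fun t => cos (airy_phase x t))), ex_RInt_airy.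
  - apply is_RInt_airy_phase. }
apply (is_derive_RInt_param (fun u t => - (t * sin (airy_phase u t)))).
- apply filter_forall. intros y t _. eexists. apply HD.
- intros t _. apply continuity_2d_pt_ext with (fun u v => - (v ^ 2 * cos (airy_phase u v))).
  { intros u v. symmetry. now apply is_derive_unique. }
  unfold airy_phase. apply continuity_2d_pt_opp, continuity_2d_pt_mult.
  { apply (continuity_1d_2d_pt_comp (fun v => v ^ 2) (fun u v => v)); [|apply continuity_2d_pt_id2].
    apply continuity_pt_filterlim, (ex_derive_continuous (fun v : R => v ^ 2)). auto_derive; easy. }
  apply (continuity_1d_2d_pt_comp cos); [apply continuity_pt_filterlim, continuous_cos|].
  apply (continuity_2d_pt_plus (fun u v => v ^ 3 / 3) (fun u v => u * v)).
  + apply (continuity_1d_2d_pt_comp (fun v => v ^ 3 / 3) (fun u v => v)); [|apply continuity_2d_pt_id2].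
    apply continuity_pt_filterlim, (ex_derive_continuous (fun v : R => v ^ 3 / 3)). auto_derive; easy.
  + apply continuity_2d_pt_mult; [apply continuity_2d_pt_id1|apply continuity_2d_pt_id2].
- apply filter_forall. intros y. apply (ex_RInt_continuous (fun t => - (t * sin (airy_phase y t)))). intros t _.
  apply (ex_derive_continuous (fun t => - (t * sin (airy_phase y t)))). unfold airy_phase. auto_derive; easy.
Qed.

Lemma is_derive_airy_trunc_bound (x T : R) :
  is_derive (fun T => airy_trunc T x) T (cos (airy_phase x T)).
Proof.
apply (is_derive_RInt (fun t => cos (airy_phase x t)) (fun T => airy_trunc T x) 0).
- apply filter_forall. intros b. apply (RInt_correct (fun t => cos (airy_phase x t))), ex_RInt_airy.
- apply (ex_derive_continuous (fun t => cos (airy_phase x t))). unfold airy_phase. auto_derive; easy.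
Qed.

Lemma is_derive_airy_trunc1_bound (x T : R) :
  is_derive (fun T => airy_trunc1 T x) T (- (T * sin (airy_phase x T))).
Proof.
assert (Hc : forall t, continuous (fun t => - (t * sin (airy_phase x t))) t).
{ intros t. apply (ex_derive_continuous (fun t => - (t * sin (airy_phase x t)))).
  unfold airy_phase. auto_derive; easy. }
apply (is_derive_RInt (fun t => - (t * sin (airy_phase x t))) (fun T => airy_trunc1 T x) 0); [|apply Hc].
apply filter_forall. intros b. apply (RInt_correct (fun t => - (t * sin (airy_phase x t)))).
apply (ex_RInt_continuous (fun t => - (t * sin (airy_phase x t)))). intros; apply Hc.
Qed.

Lemma cauchy_at_infinity (F : R -> R) (C : R) :
  (forall a b, 1 <= a <= b -> Rabs (F b - F a) <= C / a) ->
  exists l, filterlim F (Rbar_locally p_infty) (locally l).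
Proof.
intros H. apply (filterlim_locally_cauchy (U := R_CompleteSpace)). intros eps.
set (M := Rmax 1 (C / eps)).
exists (fun T => M < T). split; [now exists M|].
assert (Hw : forall u v, M < u -> u <= v -> Rabs (F v - F u) < eps).
{ intros u v Hu Huv.
  assert (1 < u) by (generalize (Rmax_l 1 (C / eps)); unfold M in *; lra).
  apply Rle_lt_trans with (C / u); [apply H; lra|].
  assert (C / eps < u) by (generalize (Rmax_r 1 (C / eps)); unfold M in *; lra).
  pose proof (cond_pos eps). apply Rlt_div_l; [lra|]. apply Rlt_div_l in H1; lra. }
intros u v Hu Hv. change (Rabs (F v - F u) < eps).
destruct (Rle_dec u v); [now apply Hw|]. rewrite Rabs_minus_sym. apply Hw; lra.
Qed.

Lemma Rabs_sin_le (x : R) : Rabs (sin x) <= 1.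
Proof. apply Rabs_le, SIN_bound. Qed.

Lemma Rabs_cos_le (x : R) : Rabs (cos x) <= 1.
Proof. apply Rabs_le, COS_bound. Qed.

(** By parts, cos (t^3/3) is the derivative of sin (t^3/3) / t^2 plus 2 sin (t^3/3) / t^3.
    Convergence is proved by hand only at x = 0; the differential equation carries it to other x. *)
Lemma airy_trunc_0_cv :
  exists l, filterlim (fun T => airy_trunc T 0) (Rbar_locally p_infty) (locally l).
Proof.
apply cauchy_at_infinity with 3. intros a b [Ha Hab].
set (s := fun t => sin (airy_phase 0 t) / t ^ 2).
assert (Hs : forall t, a <= t -> Rabs (s t) <= / a).
{ intros t Ht. unfold s, Rdiv. rewrite Rabs_mult, (Rabs_pos_eq (/ _))
    by (left; apply Rinv_0_lt_compat, pow_lt; lra).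
  apply Rle_trans with (1 * / t ^ 2).
  - apply Rmult_le_compat_r; [left; apply Rinv_0_lt_compat, pow_lt; lra|apply Rabs_sin_le].
  - rewrite Rmult_1_l. apply Rinv_le_contravar; [lra|]. simpl. nra. }
assert (HG : Rabs ((airy_trunc b 0 - s b) - (airy_trunc a 0 - s a)) <= - / b ^ 2 - - / a ^ 2).
{ apply (derive_abs_le (fun t => airy_trunc t 0 - s t) (fun t => 2 * sin (airy_phase 0 t) / t ^ 3)
    (fun t => - / t ^ 2) (fun t => 2 / t ^ 3) a b Hab).
  - intros t Ht. replace (2 * sin (airy_phase 0 t) / t ^ 3)
      with (cos (airy_phase 0 t) - (cos (airy_phase 0 t) - 2 * sin (airy_phase 0 t) / t ^ 3)) by ring.
    apply (is_derive_minus (fun t => airy_trunc t 0) s); [apply is_derive_airy_trunc_bound|].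
    unfold s, airy_phase. auto_derive; [simpl; nra|]. simpl. unfold Rdiv. field. lra.
  - intros t Ht. auto_derive; [simpl; nra|]. simpl. field. lra.
  - intros t Ht. unfold Rdiv. rewrite !Rabs_mult, (Rabs_pos_eq (/ _))
    by (left; apply Rinv_0_lt_compat, pow_lt; lra).
    apply Rmult_le_compat_r; [left; apply Rinv_0_lt_compat, pow_lt; lra|].
    rewrite (Rabs_pos_eq 2) by lra. generalize (Rabs_sin_le (airy_phase 0 t)); lra. }
pose proof (Hs a ltac:(lra)) as Ha1. pose proof (Hs b ltac:(lra)) as Hb1.
assert (0 < / b ^ 2) by (apply Rinv_0_lt_compat, pow_lt; lra).
assert (/ a ^ 2 <= / a) by (apply Rinv_le_contravar; [lra|simpl; nra]).
apply Rabs_le_between in HG, Ha1, Hb1. apply Rabs_le. unfold Rdiv. lra.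
Qed.

Lemma airy_trunc1_0_cv :
  exists l, filterlim (fun T => airy_trunc1 T 0) (Rbar_locally p_infty) (locally l).
Proof.
apply cauchy_at_infinity with 3. intros a b [Ha Hab].
(* By parts again: - t sin (t^3/3) is the derivative of [s] plus cos (t^3/3) / t^2. *)
set (s := fun t => cos (airy_phase 0 t) / t).
assert (Hs : forall t, a <= t -> Rabs (s t) <= / a).
{ intros t Ht. unfold s, Rdiv. rewrite Rabs_mult, (Rabs_pos_eq (/ _))
    by (left; apply Rinv_0_lt_compat; lra).
  apply Rle_trans with (1 * / t).
  - apply Rmult_le_compat_r; [left; apply Rinv_0_lt_compat; lra|apply Rabs_cos_le].
  - rewrite Rmult_1_l. apply Rinv_le_contravar; lra. }
assert (HG : Rabs ((airy_trunc1 b 0 - s b) - (airy_trunc1 a 0 - s a)) <= - / b - - / a).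
{ apply (derive_abs_le (fun t => airy_trunc1 t 0 - s t) (fun t => cos (airy_phase 0 t) / t ^ 2)
    (fun t => - / t) (fun t => 1 / t ^ 2) a b Hab).
  - intros t Ht. replace (cos (airy_phase 0 t) / t ^ 2)
      with (- (t * sin (airy_phase 0 t)) - (- (t * sin (airy_phase 0 t)) - cos (airy_phase 0 t) / t ^ 2)) by ring.
    apply (is_derive_minus (fun t => airy_trunc1 t 0) s); [apply is_derive_airy_trunc1_bound|].
    unfold s, airy_phase. auto_derive; [simpl; nra|]. simpl. unfold Rdiv. field. lra.
  - intros t Ht. auto_derive; [simpl; nra|]. simpl. field. lra.
  - intros t Ht. unfold Rdiv. rewrite !Rabs_mult, (Rabs_pos_eq (/ _))
    by (left; apply Rinv_0_lt_compat, pow_lt; lra).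
    apply Rmult_le_compat_r; [left; apply Rinv_0_lt_compat, pow_lt; lra|apply Rabs_cos_le]. }
pose proof (Hs a ltac:(lra)) as Ha1. pose proof (Hs b ltac:(lra)) as Hb1.
assert (0 < / b) by (apply Rinv_0_lt_compat; lra).
apply Rabs_le_between in HG, Ha1, Hb1. apply Rabs_le. unfold Rdiv. lra.
Qed.

(** Integration by parts: [cos p = (sin p)' / (t^2 + x)] for the phase [p]. *)
Lemma airy_trunc_bound (x T : R) : 0 < x -> 0 <= T -> Rabs (airy_trunc T x) <= 2 / x.
Proof.
intros Hx HT.
assert (Hpos : forall t, 0 < t ^ 2 + x) by (intros t; generalize (pow2_ge_0 t); lra).
set (s := fun t => sin (airy_phase x t) / (t ^ 2 + x)).
assert (HG : Rabs ((airy_trunc T x - s T) - (airy_trunc 0 x - s 0)) <= - / (T ^ 2 + x) - - / (0 ^ 2 + x)).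
{ apply (derive_abs_le (fun t => airy_trunc t x - s t) (fun t => 2 * t * sin (airy_phase x t) / (t ^ 2 + x) ^ 2)
    (fun t => - / (t ^ 2 + x)) (fun t => 2 * t / (t ^ 2 + x) ^ 2) 0 T HT).
  - intros t Ht. specialize (Hpos t).
    replace (2 * t * sin (airy_phase x t) / (t ^ 2 + x) ^ 2)
      with (cos (airy_phase x t) - (cos (airy_phase x t) - 2 * t * sin (airy_phase x t) / (t ^ 2 + x) ^ 2)) by ring.
    apply (is_derive_minus (fun t => airy_trunc t x) s); [apply is_derive_airy_trunc_bound|].
    unfold s, airy_phase. simpl in Hpos. auto_derive; [lra|]. simpl. unfold Rdiv. field. lra.
  - intros t Ht. specialize (Hpos t). simpl in Hpos. auto_derive; [lra|]. simpl. field. lra.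
  - intros t Ht. unfold Rdiv. rewrite !Rabs_mult, (Rabs_pos_eq (/ _))
    by (left; apply Rinv_0_lt_compat, pow_lt, Hpos).
    apply Rmult_le_compat_r; [left; apply Rinv_0_lt_compat, pow_lt, Hpos|].
    rewrite (Rabs_pos_eq 2), (Rabs_pos_eq t) by lra.
    generalize (Rabs_sin_le (airy_phase x t)). nra. }
assert (H0 : airy_trunc 0 x - s 0 = 0).
{ unfold airy_trunc, s, airy_phase at 2. rewrite RInt_point.
  replace (0 ^ 3 / 3 + x * 0) with 0 by field. rewrite sin_0. unfold zero; simpl. field. lra. }
rewrite H0 in HG. replace (0 ^ 2 + x) with x in HG by ring.
assert (Hs : Rabs (s T) <= / (T ^ 2 + x)).
{ specialize (Hpos T). unfold s, Rdiv. rewrite Rabs_mult, (Rabs_pos_eq (/ _)) by (left; now apply Rinv_0_lt_compat).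
  rewrite <- (Rmult_1_l (/ (T ^ 2 + x))) at 2. apply Rmult_le_compat_r; [left; now apply Rinv_0_lt_compat|apply Rabs_sin_le]. }
assert (0 < / x) by now apply Rinv_0_lt_compat.
apply Rabs_le_between in HG, Hs. apply Rabs_le. unfold Rdiv. lra.
Qed.

Lemma Rabs_double_mult_le (u v : R) : Rabs (2 * u * v) <= u ^ 2 + v ^ 2.
Proof. apply Rabs_le. generalize (pow2_ge_0 (u - v)), (pow2_ge_0 (u + v)). lra. Qed.

(** The truncated integral [A_T] satisfies [A_T'' = x A_T - sin (T^3 / 3 + x T)];
    subtracting [sin (T^3 / 3 + x T) / T^2] absorbs the oscillating term, and
    the remaining error is controlled by Gronwall's inequality. *)
Lemma airy_trunc_error (y y1 : R -> R) (x T : R) : airy_pair y y1 -> 1 <= T ->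
  (airy_trunc T x - y x) ^ 2 <=
  (2 * exp ((2 + Rabs x) * Rabs x) * (4 + x ^ 2) + 2) *
  ((airy_trunc T 0 - y 0) ^ 2 + (airy_trunc1 T 0 - y1 0) ^ 2 + (/ T) ^ 2).
Proof.
intros Hy HT. set (X := Rabs x). set (i := / T).
assert (Hi : 0 < i <= 1).
{ split; [apply Rinv_0_lt_compat; lra|]. unfold i. rewrite <- Rinv_1. apply Rinv_le_contravar; lra. }
assert (HX : 0 <= X) by apply Rabs_pos.
assert (HX2 : X ^ 2 = x ^ 2) by apply pow2_abs.
set (S z := sin (airy_phase z T)). set (C z := cos (airy_phase z T)).
assert (HS : forall z, S z ^ 2 <= 1).
{ intros z. unfold S. generalize (sin2_cos2 (airy_phase z T)). unfold Rsqr. nra. }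
assert (HC : forall z, C z ^ 2 <= 1).
{ intros z. unfold C. generalize (sin2_cos2 (airy_phase z T)). unfold Rsqr. nra. }
set (H z := airy_trunc T z - y z - S z * i ^ 2).
set (H1 z := airy_trunc1 T z - y1 z - C z * i).
(* The constant [X ^ 2 * i ^ 4] dominates the square of the forcing [z * S z * i ^ 2] in the
   derivative of [H1], so that the homogeneous inequality |Z'| <= (2 + X) Z holds. *)
set (Z z := H z ^ 2 + H1 z ^ 2 + X ^ 2 * i ^ 4).
assert (HZ : Z x <= Z 0 * exp ((2 + X) * Rabs x)).
{ apply (gronwall Z (fun z => 2 * H z * H1 z + 2 * H1 z * (z * (H z + S z * i ^ 2)))).
  intros z Hz. fold X in Hz. split.
  - assert (HTi : T * i = 1) by (unfold i; field; lra).
    destruct (Hy z) as [Dy Dy1].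
    assert (D1 : is_derive H z (H1 z)).
    { replace (H1 z) with (airy_trunc1 T z - y1 z - T * C z * i ^ 2)
        by (unfold H1; replace (T * C z * i ^ 2) with (T * i * C z * i) by ring; rewrite HTi; ring).
      apply (is_derive_minus (fun z => airy_trunc T z - y z) (fun z => S z * i ^ 2)).
      - apply (is_derive_minus (airy_trunc T) y); [apply is_derive_airy_trunc|exact Dy].
      - unfold S, C, airy_phase. auto_derive; [easy|]. simpl. ring. }
    assert (D2 : is_derive H1 z (z * (H z + S z * i ^ 2))).
    { replace (z * (H z + S z * i ^ 2)) with (z * airy_trunc T z - S z - z * y z - (- (T * S z * i)))
        by (unfold H; replace (T * S z * i) with (T * i * S z) by ring; rewrite HTi; ring).
      apply (is_derive_minus (fun z => airy_trunc1 T z - y1 z) (fun z => C z * i)).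
      - apply (is_derive_minus (airy_trunc1 T) y1); [apply is_derive_airy_trunc1|exact Dy1].
      - unfold S, C, airy_phase. auto_derive; [easy|]. simpl. ring. }
    unfold Z. auto_derive.
    + split; [eexists; exact D1|]. split; [eexists; exact D2|easy].
    + derive_rewrite D1. derive_rewrite D2. ring.
  - unfold Z. apply Rabs_le_between in Hz. specialize (HS z).
    assert (Hz2 : z ^ 2 <= X ^ 2) by nra.
    set (h := H z) in *. set (h1 := H1 z) in *. set (r := z * S z * i ^ 2).
    assert (Hr : r ^ 2 <= X ^ 2 * i ^ 4).
    { unfold r. replace ((z * S z * i ^ 2) ^ 2) with ((z ^ 2 * S z ^ 2) * i ^ 4) by ring.
      apply Rmult_le_compat_r; [apply pow_le; lra|]. generalize (pow2_ge_0 z), (pow2_ge_0 (S z)). nra. }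
    assert (0 <= X ^ 2 * i ^ 4) by (apply Rmult_le_pos; apply pow_le; lra).
    replace (2 * h * h1 + 2 * h1 * (z * (h + S z * i ^ 2))) with (2 * h * h1 + z * (2 * h1 * h) + 2 * h1 * r) by (unfold r; ring).
    pose proof (Rabs_double_mult_le h h1) as E1.
    pose proof (Rabs_double_mult_le h1 r) as E2.
    assert (E3 : Rabs (z * (2 * h1 * h)) <= X * (h ^ 2 + h1 ^ 2)).
    { rewrite Rabs_mult. apply Rmult_le_compat; try apply Rabs_pos.
      - apply Rabs_le; lra.
      - replace (2 * h1 * h) with (2 * h * h1) by ring. exact E1. }
    etransitivity; [apply Rabs_triang|]. etransitivity; [apply Rplus_le_compat_r, Rabs_triang|].
    nra. }
fold X in HZ. set (K := exp ((2 + X) * X)) in *.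
assert (HK : 0 < K) by apply exp_pos.
set (p := airy_trunc T 0 - y 0) in *. set (q := airy_trunc1 T 0 - y1 0) in *.
assert (Hi2 : 0 <= i ^ 2 <= 1) by (simpl; nra).
assert (Hi4 : 0 <= i ^ 4 <= i ^ 2) by (replace (i ^ 4) with (i ^ 2 * i ^ 2) by ring; nra).
assert (HZ0 : Z 0 <= (4 + x ^ 2) * (p ^ 2 + q ^ 2 + i ^ 2)).
{ unfold Z, H, H1. fold p q. specialize (HS 0). specialize (HC 0).
  assert (F1 : (p - S 0 * i ^ 2) ^ 2 <= 2 * p ^ 2 + 2 * i ^ 2).
  { assert ((S 0 * i ^ 2) ^ 2 <= i ^ 2).
    { replace ((S 0 * i ^ 2) ^ 2) with (S 0 ^ 2 * i ^ 4) by ring. generalize (pow2_ge_0 (S 0)). nra. }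
    generalize (pow2_ge_0 (p + S 0 * i ^ 2)). nra. }
  assert (F2 : (q - C 0 * i) ^ 2 <= 2 * q ^ 2 + 2 * i ^ 2).
  { assert ((C 0 * i) ^ 2 <= i ^ 2).
    { replace ((C 0 * i) ^ 2) with (C 0 ^ 2 * i ^ 2) by ring. generalize (pow2_ge_0 (C 0)). nra. }
    generalize (pow2_ge_0 (q + C 0 * i)). nra. }
  assert (F3 : X ^ 2 * i ^ 4 <= x ^ 2 * i ^ 2).
  { rewrite HX2. apply Rmult_le_compat_l; [apply pow2_ge_0|lra]. }
  generalize (pow2_ge_0 p), (pow2_ge_0 q), (pow2_ge_0 x). nra. }
assert (HH : H x ^ 2 <= Z x).
{ unfold Z. generalize (pow2_ge_0 (H1 x)). assert (0 <= X ^ 2 * i ^ 4) by (apply Rmult_le_pos; apply pow_le; lra). lra. }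
assert (HA : (airy_trunc T x - y x) ^ 2 <= 2 * H x ^ 2 + 2 * i ^ 2).
{ replace (airy_trunc T x - y x) with (H x + S x * i ^ 2) by (unfold H; ring). specialize (HS x).
  assert ((S x * i ^ 2) ^ 2 <= i ^ 2).
  { replace ((S x * i ^ 2) ^ 2) with (S x ^ 2 * i ^ 4) by ring. generalize (pow2_ge_0 (S x)). nra. }
  generalize (pow2_ge_0 (H x - S x * i ^ 2)). nra. }
assert (HP : Z 0 * K <= (4 + x ^ 2) * (p ^ 2 + q ^ 2 + i ^ 2) * K) by (apply Rmult_le_compat_r; lra).
generalize (pow2_ge_0 p), (pow2_ge_0 q). intros.
apply Rle_trans with (2 * ((4 + x ^ 2) * (p ^ 2 + q ^ 2 + i ^ 2) * K) + 2 * i ^ 2); [lra|].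
replace ((2 * K * (4 + x ^ 2) + 2) * (p ^ 2 + q ^ 2 + i ^ 2))
 with (2 * ((4 + x ^ 2) * (p ^ 2 + q ^ 2 + i ^ 2) * K) + 2 * (p ^ 2 + q ^ 2 + i ^ 2)) by ring.
lra.
Qed.

Lemma airy_trunc_cv (y y1 : R -> R) (x : R) : airy_pair y y1 ->
  filterlim (fun T => airy_trunc T 0) (Rbar_locally p_infty) (locally (y 0)) ->
  filterlim (fun T => airy_trunc1 T 0) (Rbar_locally p_infty) (locally (y1 0)) ->
  filterlim (fun T => airy_trunc T x) (Rbar_locally p_infty) (locally (y x)).
Proof.
intros Hy L0 L1.
apply filterlim_locally. intros eps.
set (K := 2 * exp ((2 + Rabs x) * Rabs x) * (4 + x ^ 2) + 2).
assert (HK : 0 < K).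
{ assert (0 < exp ((2 + Rabs x) * Rabs x) * (4 + x ^ 2)); [|unfold K; lra].
  apply Rmult_lt_0_compat; [apply exp_pos|generalize (pow2_ge_0 x); lra]. }
assert (Heta : 0 < eps / (3 * (1 + K))) by (apply Rdiv_lt_0_compat; [apply cond_pos|lra]).
set (eta := mkposreal _ Heta).
pose proof (proj1 (filterlim_locally _ _) L0 eta) as E0.
pose proof (proj1 (filterlim_locally _ _) L1 eta) as E1.
assert (E2 : Rbar_locally p_infty (fun T => Rmax 1 (/ eta) < T)) by now exists (Rmax 1 (/ eta)).
generalize (filter_and _ _ E0 (filter_and _ _ E1 E2)). apply filter_imp. intros T [B0 [B1 B2]].
change (Rabs (airy_trunc T 0 - y 0) < eta) in B0.
change (Rabs (airy_trunc1 T 0 - y1 0) < eta) in B1.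
change (Rabs (airy_trunc T x - y x) < eps).
assert (HT : 1 <= T) by (generalize (Rmax_l 1 (/ eta)); lra).
assert (B3 : 0 < / T < eta).
{ split; [apply Rinv_0_lt_compat; lra|]. rewrite <- (Rinv_inv eta).
  apply Rinv_lt_contravar; [|generalize (Rmax_r 1 (/ eta)); lra].
  apply Rmult_lt_0_compat; [apply Rinv_0_lt_compat, cond_pos|lra]. }
pose proof (airy_trunc_error y y1 x T Hy HT) as HE. fold K in HE.
set (p := airy_trunc T 0 - y 0) in *. set (q := airy_trunc1 T 0 - y1 0) in *.
set (e := airy_trunc T x - y x) in *. set (i := / T) in *.
apply Rabs_lt_between in B0, B1.
assert (Hev : 0 < eta) by apply cond_pos.
assert (He : 3 * (1 + K) * eta = eps) by (simpl; field; lra).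
assert (HB : p ^ 2 + q ^ 2 + i ^ 2 <= 3 * eta ^ 2) by nra.
assert (HF : e ^ 2 < eps ^ 2).
{ apply Rle_lt_trans with (K * (3 * eta ^ 2)).
  - apply Rle_trans with (1 := HE). apply Rmult_le_compat_l; lra.
  - rewrite <- He. assert (0 < eta ^ 2) by (apply pow_lt; lra).
    replace ((3 * (1 + K) * eta) ^ 2) with ((9 * (1 + K) ^ 2) * eta ^ 2) by ring.
    replace (K * (3 * eta ^ 2)) with (3 * K * eta ^ 2) by ring.
    apply Rmult_lt_compat_r; [easy|]. nra. }
pose proof (cond_pos eps). apply Rabs_lt_between. nra.
Qed.

Lemma is_RInt_gen_airy (x l : R) :
  filterlim (fun T => airy_trunc T x) (Rbar_locally p_infty) (locally l) ->
  is_RInt_gen (fun t => cos (t ^ 3 / 3 + x * t)) (at_point 0) (Rbar_locally p_infty) l.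
Proof.
intros H P HP. specialize (H P HP).
apply Filter_prod with (fun a => a = 0) (fun T => P (airy_trunc T x)).
- reflexivity.
- exact H.
- intros a T -> HT. exists (airy_trunc T x). split; [|exact HT].
  apply (RInt_correct (fun t => cos (airy_phase x t))), ex_RInt_airy.
Qed.

Lemma airy_pair_scal (k : R) (y y1 : R -> R) :
  airy_pair y y1 -> airy_pair (fun x => k * y x) (fun x => k * y1 x).
Proof.
intros H x. destruct (H x) as [H0 H1]. split.
- now apply is_derive_scal.
- replace (x * (k * y x)) with (k * (x * y x)) by ring. now apply is_derive_scal.
Qed.

(** The limits at x = 0 of the truncated integral and of its x-derivative serve as initial data; the
    solution with these data is the limit for every x. *)
Lemma Ai_airy_pair : exists Ai1, airy_pair Ai Ai1.
Proof.
destruct airy_trunc_0_cv as [l0 H0]. destruct airy_trunc1_0_cv as [l1 H1].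
destruct (airy_ivp l0 l1) as [y [y1 [Hy [<- <-]]]].
exists (fun x => / PI * y1 x). intros x.
assert (HAi : forall x, / PI * y x = Ai x).
{ intros z. unfold Ai. f_equal. symmetry. apply is_RInt_gen_unique.
  apply is_RInt_gen_airy. now apply (airy_trunc_cv y y1). }
destruct (airy_pair_scal (/ PI) y y1 Hy x) as [D0 D1]. rewrite HAi in D1. split; [|exact D1].
now apply (is_derive_ext (fun x => / PI * y x)).
Qed.

Lemma Ai_bound (x : R) : 0 < x -> Rabs (Ai x) <= 2 / x.
Proof.
intros Hx.
destruct airy_trunc_0_cv as [l0 H0]. destruct airy_trunc1_0_cv as [l1 H1].
destruct (airy_ivp l0 l1) as [y [y1 [Hy [<- <-]]]].
pose proof (airy_trunc_cv y y1 x Hy H0 H1) as L.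
unfold Ai. rewrite (is_RInt_gen_unique _ _ (is_RInt_gen_airy x _ L)).
assert (Hb : Rabs (y x) <= 2 / x).
{ apply (filterlim_le (F := Rbar_locally p_infty) (fun T => Rabs (airy_trunc T x)) (fun _ => 2 / x) (Rabs (y x)) (2 / x)).
  - exists 0. intros T HT. apply airy_trunc_bound; lra.
  - apply (filterlim_comp _ _ _ _ Rabs _ (locally (y x))); [exact L|]. apply continuous_Rabs.
  - apply filterlim_const. }
generalize PI2_1, (Rabs_pos (y x)). intros HPI HP.
rewrite Rabs_mult, Rabs_pos_eq by (left; apply Rinv_0_lt_compat; lra).
assert (/ PI <= 1) by (rewrite <- Rinv_1; apply Rinv_le_contravar; lra).
assert (0 < / PI) by (apply Rinv_0_lt_compat; lra). nra.
Qed.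

(** * Signs of a decaying solution and of its derivative *)

Lemma derive_continuous (f f' : R -> R) (x : R) : is_derive f x (f' x) -> continuous f x.
Proof. intros H. apply (ex_derive_continuous f). now exists (f' x). Qed.

Lemma positive_of_no_zero (f f' : R -> R) (a b : R) : a <= b ->
  (forall x, is_derive f x (f' x)) ->
  (forall x, a <= x <= b -> f x <> 0) -> (0 < f a <-> 0 < f b).
Proof.
intros Hab Hf Hnz.
assert (Hc : continuity f).
{ intros x. apply continuity_pt_filterlim, (derive_continuous f f'), Hf. }
assert (Ha : f a <> 0) by (apply Hnz; lra). assert (Hb : f b <> 0) by (apply Hnz; lra).
assert (H : ~ (Rmin (f a) (f b) <= 0 <= Rmax (f a) (f b))).
{ intros H. destruct (IVT_gen f a b 0 Hc H) as [x [Hx Hx0]].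
  rewrite Rmin_left, Rmax_right in Hx by lra. now apply (Hnz x). }
unfold Rmin, Rmax in H. destruct (Rle_dec (f a) (f b)); lra.
Qed.

(** Gronwall's inequality for y^2 + y1^2, recentred at [p], where it vanishes. *)
Lemma airy_pair_unique (y y1 : R -> R) (p : R) : airy_pair y y1 ->
  y p = 0 -> y1 p = 0 -> forall x, y1 x = 0.
Proof.
intros Hy H0 H1 x.
set (Z z := y (p + z) ^ 2 + y1 (p + z) ^ 2).
assert (HZ : Z (x - p) <= Z 0 * exp ((1 + Rabs p + Rabs (x - p)) * Rabs (x - p))).
{ apply (gronwall Z (fun z => 2 * y (p + z) * y1 (p + z) + (p + z) * (2 * y (p + z) * y1 (p + z)))).
  intros z Hz. destruct (Hy (p + z)) as [D0 D1]. split.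
  - unfold Z. auto_derive.
    + split; [eexists; exact D0|]. split; [eexists; exact D1|easy].
    + derive_rewrite D0. derive_rewrite D1. ring.
  - pose proof (Rabs_double_mult_le (y (p + z)) (y1 (p + z))) as HD. fold (Z z) in HD.
    set (w := 2 * y (p + z) * y1 (p + z)) in *.
    etransitivity; [apply Rabs_triang|]. rewrite Rabs_mult.
    assert (Rabs (p + z) <= Rabs p + Rabs (x - p)) by (etransitivity; [apply Rabs_triang|lra]).
    pose proof (Rabs_pos w). pose proof (Rabs_pos (p + z)).
    assert (Rabs (p + z) * Rabs w <= (Rabs p + Rabs (x - p)) * Z z) by (apply Rmult_le_compat; lra).
    lra. }
unfold Z in HZ. rewrite Rplus_0_r, H0, H1 in HZ.
replace (p + (x - p)) with x in HZ by ring.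
generalize (pow2_ge_0 (y x)). intros. nra.
Qed.

(** On x >= 0 the derivative y1^2 + x y^2 of y y1 is nonnegative. A positive value c would persist
    to the right and make y^2 grow with slope at least 2 c, against decay. *)
Lemma airy_product_nonpos (y y1 : R -> R) : airy_pair y y1 ->
  (forall x, 0 < x -> Rabs (y x) <= 2 / x) ->
  forall x, 0 <= x -> y x * y1 x <= 0.
Proof.
intros Hy Hb x0 Hx0. apply Rnot_lt_le. intros Hc. set (c := y x0 * y1 x0) in *.
assert (Hmono : forall x, x0 <= x -> c <= y x * y1 x).
{ intros x Hx. apply Ropp_le_cancel.
  apply (derive_nonpos_decr (fun x => - (y x * y1 x)) (fun x => - (y1 x ^ 2 + x * y x ^ 2)) x0 x Hx).
  - intros z Hz. destruct (Hy z) as [D0 D1]. auto_derive.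
    + split; [eexists; exact D0|]. split; [eexists; exact D1|easy].
    + derive_rewrite D0. derive_rewrite D1. ring.
  - intros z Hz. generalize (pow2_ge_0 (y1 z)), (pow2_ge_0 (y z)). nra. }
(* Here x >= 1 gives y(x)^2 <= 4, while growth from [x0] forces y(x)^2 >= 2 c + 4. *)
set (x := x0 + 1 + 2 / c).
assert (Hx : x0 + 1 <= x) by (unfold x; assert (0 <= 2 / c) by (apply Rdiv_le_0_compat; lra); lra).
assert (Hgrow : 2 * c * x - y x ^ 2 <= 2 * c * x0 - y x0 ^ 2).
{ apply (derive_nonpos_decr (fun x => 2 * c * x - y x ^ 2) (fun x => 2 * c - 2 * (y x * y1 x)) x0 x); [lra| |].
  - intros z Hz. destruct (Hy z) as [D0 _]. auto_derive; [eexists; exact D0|]. derive_rewrite D0. ring.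
  - intros z Hz. specialize (Hmono z ltac:(lra)). lra. }
assert (Hcx : 2 * c * (x - x0) = 2 * c + 4) by (unfold x; field; lra).
specialize (Hb x ltac:(lra)).
assert (2 / x <= 2) by (apply Rle_div_l; lra).
assert (Rabs (y x) ^ 2 <= 4) by (generalize (Rabs_pos (y x)); nra). rewrite pow2_abs in H0.
generalize (pow2_ge_0 (y x0)). nra.
Qed.

(** From a zero on, y y1 is nondecreasing from 0 and nonpositive, hence constant. Its derivative
    y1^2 + t y^2 vanishes at t = x + 1 > 0, so both functions vanish there, and uniqueness kills
    y1. *)
Lemma airy_nonzero (y y1 : R -> R) : airy_pair y y1 ->
  (forall x, 0 < x -> Rabs (y x) <= 2 / x) -> (exists x, y1 x <> 0) ->
  forall x, 0 <= x -> y x <> 0.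
Proof.
intros Hy Hb [z Hz] x Hx H0. apply Hz. clear Hz.
assert (HF : forall t, is_derive (fun x => y x * y1 x) t (y1 t ^ 2 + t * y t ^ 2)).
{ intros t. destruct (Hy t) as [D0 D1]. auto_derive.
  - split; [eexists; exact D0|]. split; [eexists; exact D1|easy].
  - derive_rewrite D0. derive_rewrite D1. ring. }
assert (Hzero : forall t, x <= t -> y t * y1 t = 0).
{ intros t Ht. apply Rle_antisym; [apply airy_product_nonpos; auto; lra|].
  replace 0 with (y x * y1 x) by (rewrite H0; ring). apply Ropp_le_cancel.
  apply (derive_nonpos_decr (fun x => - (y x * y1 x)) (fun x => - (y1 x ^ 2 + x * y x ^ 2)) x t Ht).
  - intros s Hs. now apply (is_derive_opp (fun x => y x * y1 x)).
  - intros s Hs. generalize (pow2_ge_0 (y1 s)), (pow2_ge_0 (y s)). nra. }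
assert (Hd : y1 (x + 1) ^ 2 + (x + 1) * y (x + 1) ^ 2 = 0).
{ rewrite <- (is_derive_unique _ _ _ (HF (x + 1))).
  rewrite (Derive_ext_loc _ (fun _ => 0)); [apply Derive_const|].
  exists (mkposreal 1 Rlt_0_1). intros t Ht. apply Hzero.
  change (Rabs (t - (x + 1)) < 1) in Ht. apply Rabs_lt_between in Ht. lra. }
generalize (pow2_ge_0 (y1 (x + 1))), (pow2_ge_0 (y (x + 1))). intros.
apply (airy_pair_unique y y1 (x + 1)); [easy| |]; nra.
Qed.

(** The factor k = 1 or -1 normalises y(0) > 0, so the sign of Ai(0) need not be computed. For x >=
    0, y1 is strictly increasing and nonpositive, hence negative; between [a1] and 0 it has no zero
    and keeps its sign. *)
Lemma airy_sign_data (a1 : R) : largest_negative_zero (Derive Ai) a1 ->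
  exists y y1, airy_pair y y1 /\ y1 a1 = 0 /\
    (forall x, 0 < x -> Rabs (y x) <= 2 / x) /\
    (forall x, a1 <= x -> 0 < y x) /\ (forall x, a1 < x -> y1 x < 0).
Proof.
intros [Ha1 [Hz Hmax]]. destruct Ai_airy_pair as [Ai1 HAi].
assert (HD : forall x, Derive Ai x = Ai1 x).
{ intros x. apply is_derive_unique, HAi. }
(* If [Ai] vanished identically, [Derive Ai] would have no largest negative zero. *)
assert (Hne : exists x, Ai1 x <> 0).
{ exists (a1 / 2). rewrite <- HD. intros H. specialize (Hmax (a1 / 2) ltac:(lra) H). lra. }
pose proof (airy_nonzero Ai Ai1 HAi Ai_bound Hne) as Hnz.
assert (Hk : exists k, Rabs k = 1 /\ 0 < k * Ai 0).
{ destruct (Rtotal_order (Ai 0) 0) as [H|[H|H]].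
  - exists (-1). rewrite Rabs_left by lra. lra.
  - now destruct (Hnz 0 ltac:(lra)).
  - exists 1. rewrite Rabs_R1. lra. }
destruct Hk as [k [Hk1 Hk0]].
assert (Hkne : k <> 0) by (intros ->; rewrite Rabs_R0 in Hk1; lra).
set (y x := k * Ai x). set (y1 x := k * Ai1 x).
assert (Hy : airy_pair y y1) by now apply airy_pair_scal.
assert (Hb : forall x, 0 < x -> Rabs (y x) <= 2 / x).
{ intros x Hx. unfold y. rewrite Rabs_mult, Hk1, Rmult_1_l. now apply Ai_bound. }
assert (Hpos : forall x, 0 <= x -> 0 < y x).
{ intros x Hx. apply (positive_of_no_zero y y1 0 x Hx); [apply Hy| |exact Hk0].
  intros t Ht. unfold y. apply Rmult_integral_contrapositive_currified; [easy|]. apply Hnz; lra. }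
assert (Hneg0 : forall x, 0 <= x -> y1 x < 0).
{ intros x Hx.
  assert (y1 (x + 1) <= 0).
  { pose proof (airy_product_nonpos y y1 Hy Hb (x + 1) ltac:(lra)). pose proof (Hpos (x + 1) ltac:(lra)). nra. }
  destruct (mean_value y1 (fun t => t * y t) x (x + 1) ltac:(lra)) as [c [Hc He]].
  { intros t _. apply Hy. }
  pose proof (Hpos c ltac:(lra)). nra. }
assert (Hneg : forall x, a1 < x -> y1 x < 0).
{ intros x Hx. destruct (Rle_dec 0 x) as [H|H]; [now apply Hneg0|].
  assert (Hxnz : forall t, x <= t <= 0 -> - y1 t <> 0).
  { intros t Ht H0. destruct (Req_dec t 0) as [->|Ht0]; [specialize (Hneg0 0 ltac:(lra)); lra|].
    assert (Ai1 t = 0).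
    { apply (Rmult_eq_reg_l k); [|easy]. fold (y1 t). lra. }
    rewrite <- HD in H1. specialize (Hmax t ltac:(lra) H1). lra. }
  assert (0 < - y1 x); [|lra].
  apply (positive_of_no_zero (fun t => - y1 t) (fun t => - (t * y t)) x 0); [lra| |easy|].
  - intros t. apply (is_derive_opp y1), Hy.
  - specialize (Hneg0 0 ltac:(lra)). lra. }
exists y, y1. split; [easy|]. split; [unfold y1; rewrite <- HD, Hz; ring|].
split; [easy|split; [|easy]].
intros x Hx. destruct (Rle_dec 0 x) as [H|H]; [now apply Hpos|].
destruct (mean_value y y1 x 0 ltac:(lra)) as [c [Hc He]]; [intros; apply Hy|].
specialize (Hneg c ltac:(lra)). specialize (Hpos 0 ltac:(lra)). nra.
Qed.

(** * Comparison for the limiting Riccati equation *)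

(** After the last point [z] with w <= K the function would stay above K, hence be nonincreasing,
    and could not end above K. *)
Lemma barrier (w w' : R -> R) (K a b : R) : a <= b ->
  (forall x, a <= x <= b -> is_derive w x (w' x)) ->
  (forall x, a <= x <= b -> K < w x -> w' x <= 0) ->
  w a <= K -> w b <= K.
Proof.
intros Hab Hw Hw' Ha. apply Rnot_lt_le. intros Hb.
set (E := fun x => a <= x <= b /\ w x <= K).
destruct (completeness E) as [z [Hub Hlub]].
{ exists b. intros x [Hx _]. lra. }
{ exists a. split; [lra|easy]. }
assert (Haz : a <= z) by (apply Hub; split; [lra|easy]).
assert (Hzb : z <= b) by (apply Hlub; intros x [Hx _]; lra).
assert (Hz : w z <= K).
{ apply Rnot_lt_le. intros Hz.
  assert (Hc : continuous w z) by (apply (derive_continuous w w'), Hw; lra).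
  destruct (proj1 (filterlim_locally _ _) Hc (mkposreal (w z - K) ltac:(lra))) as [d Hd].
  assert (z <= z - d / 2); [|generalize (cond_pos d); lra].
  apply Hlub. intros x [Hx HxK]. apply Rnot_lt_le. intros Hlt.
  assert (x <= z) by now apply Hub.
  assert (Hball : ball z d x).
  { change (Rabs (x - z) < d). apply Rabs_lt_between. generalize (cond_pos d). lra. }
  specialize (Hd x Hball). change (Rabs (w x - w z) < w z - K) in Hd.
  apply Rabs_lt_between in Hd. lra. }
assert (Hzlt : z < b) by (destruct Hzb as [|Heq]; [easy|subst; lra]).
assert (w b <= w z); [|lra].
apply (derive_nonpos_decr w w'); [lra| |].
- intros x Hx. apply Hw. lra.
- intros x Hx. apply Hw'; [lra|]. apply Rnot_le_lt. intros HxK.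
  assert (x <= z); [|lra]. apply Hub. split; [lra|easy].
Qed.

(** [u] is [Ai], up to sign, reflected at the origin: [u s = +- Ai (- s)] and
    [s1 = |a_1'|]. *)
Record airy_profile (s1 : R) (u u1 : R -> R) : Prop := {
  profile_d : forall s, is_derive u s (u1 s);
  profile_d1 : forall s, is_derive u1 s (- s * u s);
  profile_root : u1 s1 = 0;
  profile_s1 : 0 < s1;
  profile_pos : forall s, s <= s1 -> 0 < u s;
  profile_pos1 : forall s, s < s1 -> 0 < u1 s;
  profile_decay : forall s, s < 0 -> u s <= 2 / - s
}.

Lemma airy_profile_exists (a1 : R) : largest_negative_zero (Derive Ai) a1 ->
  exists u u1, airy_profile (Rabs a1) u u1.
Proof.
intros H. assert (Ha : a1 < 0) by apply H. rewrite Rabs_left by easy.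
destruct (airy_sign_data a1 H) as [y [y1 [Hy [Hz [Hb [Hp Hn]]]]]].
exists (fun s => y (- s)), (fun s => - y1 (- s)). constructor.
- intros s. destruct (Hy (- s)) as [D0 _]. auto_derive; [eexists; exact D0|]. derive_rewrite D0. ring.
- intros s. destruct (Hy (- s)) as [_ D1]. auto_derive; [eexists; exact D1|]. derive_rewrite D1. ring.
- rewrite Ropp_involutive, Hz. ring.
- lra.
- intros s Hs. apply Hp. lra.
- intros s Hs. specialize (Hn (- s) ltac:(lra)). lra.
- intros s Hs. etransitivity; [apply Rle_abs|]. apply Hb. lra.
Qed.

Lemma profile_incr (s1 : R) (u u1 : R -> R) (s t : R) : airy_profile s1 u u1 ->
  s <= t <= 0 -> u1 s <= u1 t.
Proof.
intros P Hst. apply Ropp_le_cancel.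
apply (derive_nonpos_decr (fun x => - u1 x) (fun x => - (- x * u x)) s t); [lra| |].
- intros x _. apply (is_derive_opp u1), P.
- intros x Hx. pose proof (profile_s1 _ _ _ P). pose proof (profile_pos _ _ _ P x ltac:(lra)). nra.
Qed.

Lemma profile_decr (s1 : R) (u u1 : R -> R) (s t : R) : airy_profile s1 u u1 ->
  0 <= s <= t -> t <= s1 -> u1 t <= u1 s.
Proof.
intros P Hst Ht.
apply (derive_nonpos_decr u1 (fun x => - x * u x) s t); [lra| |].
- intros x _. apply P.
- intros x Hx. pose proof (profile_pos _ _ _ P x ltac:(lra)). nra.
Qed.

(** As u1 is nondecreasing on the negative axis, u1(s) is at most the mean slope of u on [s, s+1],
    hence at most u(s+1). *)
Lemma profile_decay1 (s1 : R) (u u1 : R -> R) (s : R) : airy_profile s1 u u1 ->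
  s < -1 -> u1 s <= 2 / (- s - 1).
Proof.
intros P Hs. destruct (mean_value u u1 s (s + 1) ltac:(lra)) as [c [Hc He]].
{ intros; apply P. }
pose proof (profile_incr _ _ _ s c P ltac:(lra)).
pose proof (profile_s1 _ _ _ P). pose proof (profile_pos _ _ _ P s ltac:(lra)).
pose proof (profile_decay _ _ _ P (s + 1) ltac:(lra)) as Hd.
replace (- (s + 1)) with (- s - 1) in Hd by ring. lra.
Qed.

(** For w = v u - u1 one finds w' = (v' + s + v^2) u - v w, nonpositive wherever w > 0. If s1 < sn,
    then w(s1) = v(s1) u(s1) > 0, although w is arbitrarily small far to the left. The bound [M] may
    depend on n. *)
Lemma riccati_upper (s1 sn M : R) (u u1 v v' : R -> R) : airy_profile s1 u u1 ->
  (forall s, s <= sn -> is_derive v s (v' s)) ->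
  (forall s, s <= sn -> 0 <= v s <= M) -> (forall s, s < sn -> 0 < v s) ->
  (forall s, s <= sn -> v' s <= - s - v s ^ 2) -> sn <= s1.
Proof.
intros P Hv Hb Hpos Hv'. apply Rnot_lt_le. intros Hlt.
pose proof (profile_s1 _ _ _ P) as Hs1.
set (eta := v s1 * u s1 / 2).
assert (Heta : 0 < v s1 * u s1) by (apply Rmult_lt_0_compat; [now apply Hpos|apply P; lra]).
assert (HM : 0 <= M) by (destruct (Hb s1); lra).
(* Far enough left that v u <= 2 M / (- s0) <= eta, which is half of w(s1). *)
set (s0 := - (1 + 2 * M / eta)).
assert (HMeta : 0 <= 2 * M / eta) by (apply Rdiv_le_0_compat; unfold eta; lra).
assert (Hs0 : s0 < 0) by (unfold s0; lra).
set (w s := v s * u s - u1 s).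
assert (H : w s1 <= eta).
{ apply (barrier w (fun s => v' s * u s + v s * u1 s + s * u s) eta s0 s1); [lra| | |].
  - intros s Hs. pose proof (Hv s ltac:(lra)) as Dv. pose proof (profile_d _ _ _ P s) as Du.
    pose proof (profile_d1 _ _ _ P s) as Du1. unfold w. auto_derive.
    + split; [eexists; exact Dv|]. split; [eexists; exact Du|]. split; [eexists; exact Du1|easy].
    + derive_rewrite Dv. derive_rewrite Du. derive_rewrite Du1. ring.
  - intros s Hs Hw. pose proof (Hv' s ltac:(lra)). pose proof (Hb s ltac:(lra)).
    pose proof (profile_pos _ _ _ P s ltac:(lra)).
    assert (v' s * u s <= (- s - v s ^ 2) * u s) by (apply Rmult_le_compat_r; lra).
    assert (0 <= v s * w s) by (apply Rmult_le_pos; unfold eta in *; lra).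
    unfold w in *. nra.
  - unfold w. pose proof (Hb s0 ltac:(lra)). pose proof (profile_pos1 _ _ _ P s0 ltac:(lra)).
    pose proof (profile_pos _ _ _ P s0 ltac:(lra)).
    assert (v s0 * u s0 <= M * (2 / - s0)).
    { apply Rmult_le_compat; try lra. apply P. lra. }
    assert (M * (2 / - s0) <= eta); [|lra].
    replace (M * (2 / - s0)) with (2 * M / - s0) by (field; lra).
    apply Rle_div_l; [lra|]. unfold s0. rewrite Ropp_involutive.
    replace (eta * (1 + 2 * M / eta)) with (eta + 2 * M) by (field; unfold eta; lra). unfold eta; lra. }
unfold w in H. rewrite (profile_root _ _ _ P) in H. unfold eta in H. lra.
Qed.

(** The reversed difference w = u1 - v u, with u shifted by [d], satisfies w' <= - v w. At - L only
    v >= 0 is needed, as it gives w <= u1; at [sn], w reduces to u1 because v vanishes. *)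
Lemma riccati_lower (s1 sn L d : R) (u u1 v v' : R -> R) : airy_profile s1 u u1 ->
  - L <= sn -> sn + d <= s1 -> v sn = 0 ->
  (forall s, - L <= s <= sn -> is_derive v s (v' s)) ->
  (forall s, - L <= s <= sn -> 0 <= v s) ->
  (forall s, - L <= s <= sn -> - (s + d) - v s ^ 2 <= v' s) ->
  u1 (sn + d) <= u1 (- L + d).
Proof.
intros P HL Hd Hv0 Hv Hpos Hv'.
set (w s := u1 (s + d) - v s * u (s + d)).
replace (u1 (sn + d)) with (w sn) by (unfold w; rewrite Hv0; ring).
(* A nonnegative level ensures that w above it is positive, so that - v w <= 0. *)
assert (HK : 0 <= u1 (- L + d)).
{ destruct (Rle_lt_or_eq_dec (- L + d) s1 ltac:(lra)) as [H|H].
  - left. now apply P.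
  - rewrite H, (profile_root _ _ _ P). lra. }
apply (barrier w (fun s => - (s + d) * u (s + d) - v' s * u (s + d) - v s * u1 (s + d)) _ (- L) sn HL).
- intros s Hs. pose proof (Hv s ltac:(lra)) as Dv. pose proof (profile_d _ _ _ P (s + d)) as Du.
  pose proof (profile_d1 _ _ _ P (s + d)) as Du1. unfold w. auto_derive.
  + split; [eexists; exact Du1|]. split; [eexists; exact Dv|]. split; [eexists; exact Du|easy].
  + derive_rewrite Dv. derive_rewrite Du. derive_rewrite Du1. ring.
- intros s Hs Hw. pose proof (Hv' s Hs). pose proof (Hpos s Hs).
  pose proof (profile_pos _ _ _ P (s + d) ltac:(lra)).
  assert ((- (s + d) - v s ^ 2) * u (s + d) <= v' s * u (s + d)) by (apply Rmult_le_compat_r; lra).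
  assert (0 <= v s * w s) by (apply Rmult_le_pos; lra).
  unfold w in *. nra.
- unfold w. pose proof (Hpos (- L) ltac:(lra)). pose proof (profile_pos _ _ _ P (- L + d) ltac:(lra)). nra.
Qed.

(** * The scaling limit *)

(** From exp (- t) >= 1 - t one gets exp t (1 - t) <= 1 <= (1 + t + 2 t^2) (1 - t), the last step by
    t <= 1/2. *)
Lemma exp_sub1_le (t : R) : Rabs t <= 1 / 2 -> exp t - 1 <= t + 2 * t ^ 2.
Proof.
intros Ht. apply Rabs_le_between in Ht.
assert (H : 1 - t <= exp (- t)) by (generalize (exp_ineq1_le (- t)); lra).
rewrite exp_Ropp in H. pose proof (exp_pos t).
assert (H1 : exp t * (1 - t) <= 1).
{ replace 1 with (exp t * / exp t) at 2 by (field; lra). apply Rmult_le_compat_l; lra. }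
assert (H2 : 1 <= (1 + t + 2 * t ^ 2) * (1 - t)).
{ replace ((1 + t + 2 * t ^ 2) * (1 - t)) with (1 + t ^ 2 * (1 - 2 * t)) by ring.
  assert (0 <= t ^ 2 * (1 - 2 * t)) by (apply Rmult_le_pos; [apply pow2_ge_0|lra]). lra. }
assert (exp t <= 1 + t + 2 * t ^ 2); [|lra].
apply (Rmult_le_reg_r (1 - t)); lra.
Qed.

Lemma exp_sub1_ge (t : R) : t <= exp t - 1.
Proof. generalize (exp_ineq1_le t). lra. Qed.

Section Scaling.
Context (a q g : R) (Ha : 1 <= a) (Hq : 0 < q) (Hqa : q ^ 3 = a)
  (Hg : 0 < g) (Lg : is_lim_seq (fun N => psum a N g) 1).

(** The boundary layer at [y = 1/2], [B = 1] of the generating function [B]: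
    [y = exp (s / q^2) / 2] and [B = 1 - v / q], where [q = n^(1/3)]. *)
Definition scaled_arg (s : R) : R := exp (s / q ^ 2) / 2.
Definition scaled_v (s : R) : R := q * (1 - PSeries (genf a) (scaled_arg s)).
Definition scaled_root : R := q ^ 2 * ln (2 * g).
Definition scaled_dv (s : R) : R :=
  - (q ^ 2 * (exp (s / q ^ 2) - 1) + scaled_v s ^ 2
     + PSeries (genf a) (scaled_arg s) / q).

Lemma scaled_arg_root : scaled_arg scaled_root = g.
Proof.
unfold scaled_arg, scaled_root.
replace (q ^ 2 * ln (2 * g) / q ^ 2) with (ln (2 * g)) by (field; lra).
rewrite exp_ln by lra. field.
Qed.

Lemma scaled_arg_pos (s : R) : 0 < scaled_arg s.
Proof. unfold scaled_arg. generalize (exp_pos (s / q ^ 2)). lra. Qed.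

Lemma scaled_arg_lt (s : R) : s < scaled_root -> scaled_arg s < g.
Proof.
intros Hs. rewrite <- scaled_arg_root. unfold scaled_arg.
apply Rmult_lt_compat_r; [lra|]. apply exp_increasing.
apply Rmult_lt_compat_r; [apply Rinv_0_lt_compat, pow_lt, Hq|exact Hs].
Qed.

Lemma scaled_arg_le (s : R) : s <= scaled_root -> scaled_arg s <= g.
Proof.
intros [Hs| ->]; [left; now apply scaled_arg_lt|right; apply scaled_arg_root].
Qed.

(** The gap [g - y] in the upper bound makes v strictly positive to the left of its root. *)
Lemma genf_bounds (y : R) : 0 < y <= g -> 0 <= PSeries (genf a) y <= 1 - (g - y).
Proof.
intros Hy.
assert (Hin : Rbar_lt (Rabs y) (CV_radius (coef a))).
{ apply Rbar_le_lt_trans with (Finite (Rabs g)); [|now apply critical_in_disk].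
  rewrite !Rabs_pos_eq by lra. apply Hy. }
assert (Ly : is_lim_seq (fun N => psum a N y) (PSeries (genf a) y)).
{ apply psum_is_series. apply (is_series_PSeries_shift (genf a)); [reflexivity|now rewrite genf_radius]. }
split.
- apply (is_lim_seq_le (fun _ => 0) (fun N => psum a N y) 0 (PSeries (genf a) y)); [|apply is_lim_seq_const|exact Ly].
  intros N. apply psum_ge0; lra.
- apply (is_lim_seq_le (fun N => psum a N y) (fun N => psum a N g - (g - y)) (PSeries (genf a) y) (1 - (g - y))).
  + intros N. generalize (psum_gap a y g N Ha ltac:(lra)). lra.
  + exact Ly.
  + apply (is_lim_seq_minus' _ _ _ _ Lg (is_lim_seq_const _)).
Qed.

Lemma is_derive_scaled_v (s : R) : s <= scaled_root -> is_derive scaled_v s (scaled_dv s).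
Proof.
intros Hs. pose proof (scaled_arg_le s Hs) as Hy. pose proof (scaled_arg_pos s) as Hy0.
assert (Hin : Rbar_lt (Rabs (scaled_arg s)) (CV_radius (coef a))).
{ apply Rbar_le_lt_trans with (Finite (Rabs g)); [|now apply critical_in_disk].
  rewrite !Rabs_pos_eq by lra. exact Hy. }
pose proof (genf_ode a _ Ha Hin) as Hode. rewrite PSeries_euler in Hode.
assert (DB : is_derive (PSeries (genf a)) (scaled_arg s) (PSeries (PS_derive (genf a)) (scaled_arg s))).
{ apply is_derive_PSeries. now rewrite genf_radius. }
assert (DA : is_derive scaled_arg s (scaled_arg s / q ^ 2)).
{ unfold scaled_arg. auto_derive; [simpl; nra|]. simpl. unfold Rdiv. field. lra. }
unfold scaled_dv, scaled_v. set (y := scaled_arg s) in *.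
set (B := PSeries (genf a) y) in *. set (B1 := PSeries (PS_derive (genf a)) y) in *.
replace (exp (s / q ^ 2)) with (2 * y) by (unfold y, scaled_arg; field; lra).
replace (- (q ^ 2 * (2 * y - 1) + (q * (1 - B)) ^ 2 + B / q)) with (q * (0 - (y / q ^ 2) * B1)).
- apply (is_derive_scal (fun s => 1 - PSeries (genf a) (scaled_arg s))).
  apply (is_derive_minus (fun _ => 1) (fun s => PSeries (genf a) (scaled_arg s))).
  + apply (is_derive_const (V := R_NormedModule)).
  + apply (is_derive_comp (PSeries (genf a)) scaled_arg); [exact DB|exact DA].
- assert (HyB : y * B1 = a * (2 * y + B ^ 2 - (2 - 1 / a) * B)).
  { rewrite <- Hode. field. lra. }
  replace (q * (0 - y / q ^ 2 * B1)) with (- (y * B1) / q) by (field; lra).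
  rewrite HyB, <- Hqa. field. lra.
Qed.

Lemma scaled_v_bounds (s : R) : s <= scaled_root -> 0 <= scaled_v s <= q.
Proof.
intros Hs. pose proof (genf_bounds (scaled_arg s)) as H.
pose proof (scaled_arg_le s Hs). pose proof (scaled_arg_pos s).
specialize (H ltac:(lra)). unfold scaled_v. nra.
Qed.

(** Both error terms help: exp t - 1 >= t and B >= 0. Thus v' <= - s - v^2 holds exactly up to the
    root, for every n. *)
Lemma scaled_root_le (s1 : R) (u u1 : R -> R) : airy_profile s1 u u1 -> scaled_root <= s1.
Proof.
intros P. apply (riccati_upper s1 scaled_root q u u1 scaled_v scaled_dv P).
- apply is_derive_scaled_v.
- apply scaled_v_bounds.
- intros s Hs. pose proof (genf_bounds (scaled_arg s)) as H.
  pose proof (scaled_arg_lt s Hs). pose proof (scaled_arg_pos s).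
  specialize (H ltac:(lra)). unfold scaled_v. apply Rmult_lt_0_compat; lra.
- intros s Hs. pose proof (genf_bounds (scaled_arg s)) as H.
  pose proof (scaled_arg_le s Hs). pose proof (scaled_arg_pos s). specialize (H ltac:(lra)).
  unfold scaled_dv.
  assert (0 <= PSeries (genf a) (scaled_arg s) / q) by (apply Rdiv_le_0_compat; lra).
  assert (q ^ 2 * (s / q ^ 2) <= q ^ 2 * (exp (s / q ^ 2) - 1))
    by (apply Rmult_le_compat_l; [apply pow2_ge_0|apply exp_sub1_ge]).
  replace (q ^ 2 * (s / q ^ 2)) with s in H3 by (field; lra). lra.
Qed.

Lemma scaled_root_ge0 : 0 <= scaled_root.
Proof.
pose proof (critical_ge_half a g Ha Hg Lg). unfold scaled_root.
apply Rmult_le_pos; [apply pow2_ge_0|]. rewrite <- ln_1. apply ln_le; lra.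
Qed.

(** [d] bounds the error on |s| <= M: the Taylor remainder of exp, plus B/q <= 1/q. If the root plus
    [d] lay left of s1 - eps, the comparison would bound u1 there by its tail value at - L + 1,
    while monotonicity makes it at least u1(s1 - eps). *)
Lemma scaled_root_ge (s1 L eps : R) (u u1 : R -> R) : airy_profile s1 u u1 ->
  let M := Rmax L s1 in
  let d := 2 * M ^ 2 / q ^ 2 + 1 / q in
  1 <= L -> M / q ^ 2 <= 1 / 2 -> d <= 1 -> 0 < eps < s1 ->
  u1 (- L + 1) < u1 (s1 - eps) ->
  s1 - eps - d <= scaled_root.
Proof.
intros P M d HS HM Hd Heps Hu. apply Rnot_lt_le. intros Hlt.
assert (Hsr := scaled_root_ge0).
assert (HML : L <= M) by apply Rmax_l. assert (HMs : s1 <= M) by apply Rmax_r.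
assert (Hd0 : 0 <= d).
{ unfold d. assert (0 <= 2 * M ^ 2 / q ^ 2) by (apply Rdiv_le_0_compat; [generalize (pow2_ge_0 M); lra|apply pow_lt, Hq]).
  assert (0 <= 1 / q) by (apply Rdiv_le_0_compat; lra). lra. }
assert (H1 : u1 (scaled_root + d) <= u1 (- L + d)).
{ apply (riccati_lower s1 scaled_root L d u u1 scaled_v scaled_dv P); try lra.
  - unfold scaled_v. rewrite scaled_arg_root, genf_critical by easy. ring.
  - intros s Hs. apply is_derive_scaled_v. lra.
  - intros s Hs. apply scaled_v_bounds. lra.
  - intros s Hs. pose proof (genf_bounds (scaled_arg s)) as H.
    pose proof (scaled_arg_le s ltac:(lra)). pose proof (scaled_arg_pos s). specialize (H ltac:(lra)).
    unfold scaled_dv.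
    assert (Hqi : 0 < / q ^ 2) by (apply Rinv_0_lt_compat, pow_lt, Hq).
    assert (HsM : Rabs s <= M) by (apply Rabs_le; lra).
    assert (Hsmall : Rabs (s / q ^ 2) <= 1 / 2).
    { unfold Rdiv. rewrite Rabs_mult, (Rabs_pos_eq (/ q ^ 2)) by lra.
      apply Rle_trans with (2 := HM). apply Rmult_le_compat_r; lra. }
    assert (H3 : q ^ 2 * (exp (s / q ^ 2) - 1) <= q ^ 2 * (s / q ^ 2 + 2 * (s / q ^ 2) ^ 2))
      by (apply Rmult_le_compat_l; [apply pow2_ge_0|now apply exp_sub1_le]).
    replace (q ^ 2 * (s / q ^ 2 + 2 * (s / q ^ 2) ^ 2)) with (s + 2 * s ^ 2 / q ^ 2) in H3 by (field; lra).
    assert (H4 : 2 * s ^ 2 / q ^ 2 <= 2 * M ^ 2 / q ^ 2).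
    { apply Rmult_le_compat_r; [lra|]. rewrite <- (pow2_abs s). generalize (Rabs_pos s). nra. }
    assert (H5 : PSeries (genf a) (scaled_arg s) / q <= 1 / q).
    { apply Rmult_le_compat_r; [left; now apply Rinv_0_lt_compat|lra]. }
    unfold d. lra. }
assert (H2 : u1 (- L + d) <= u1 (- L + 1)) by (apply (profile_incr s1 u u1); [easy|lra]).
assert (H3 : u1 (s1 - eps) <= u1 (scaled_root + d)) by (apply (profile_decr s1 u u1); [easy|lra|lra]).
lra.
Qed.

(** The middle quantity is 1 / (m_0 q). Since 2 g = exp (root / q^2), it equals q^2 (exp (root /
    q^2) - 1) + 1/q, which is the root up to O(1/q) for bounded roots. *)
Lemma scaled_mass_bounds :
  Rabs (scaled_root / q ^ 2) <= 1 / 2 ->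
  scaled_root + 1 / q <= (1 + a * (2 * g - 1)) / q
    <= scaled_root + 2 * scaled_root ^ 2 / q ^ 2 + 1 / q.
Proof.
intros Hsmall.
assert (H2g : 2 * g = exp (scaled_root / q ^ 2)).
{ rewrite <- scaled_arg_root at 1. unfold scaled_arg. field. }
rewrite H2g, <- Hqa.
replace ((1 + q ^ 3 * (exp (scaled_root / q ^ 2) - 1)) / q)
  with (q ^ 2 * (exp (scaled_root / q ^ 2) - 1) + 1 / q) by (field; lra).
pose proof (exp_sub1_le _ Hsmall) as H1. pose proof (exp_sub1_ge (scaled_root / q ^ 2)) as H0.
apply (Rmult_le_compat_l (q ^ 2)) in H1, H0; try apply pow2_ge_0.
replace (q ^ 2 * (scaled_root / q ^ 2)) with scaled_root in H0 by (field; lra).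
replace (q ^ 2 * (scaled_root / q ^ 2 + 2 * (scaled_root / q ^ 2) ^ 2))
  with (scaled_root + 2 * scaled_root ^ 2 / q ^ 2) in H1 by (field; lra).
lra.
Qed.
End Scaling.

Lemma scaled_mass_limit (s1 eps : R) (u u1 : R -> R) : airy_profile s1 u u1 -> 0 < eps ->
  exists Q, forall a q g, Q <= q -> 1 <= a -> 0 < q -> q ^ 3 = a -> 0 < g ->
    is_lim_seq (fun N => psum a N g) 1 ->
    Rabs ((1 + a * (2 * g - 1)) / q - s1) < eps.
Proof.
intros P Heps. pose proof (profile_s1 _ _ _ P) as Hs1.
(* The bound s1/2 keeps s1 - e strictly inside (0, s1), where u1 is positive. *)
set (e := Rmin (eps / 4) (s1 / 2)).
assert (He : 0 < e) by (apply Rmin_glb_lt; lra).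
assert (He1 : e <= eps / 4) by apply Rmin_l. assert (He2 : e <= s1 / 2) by apply Rmin_r.
set (k := u1 (s1 - e)). assert (Hk : 0 < k) by (apply P; lra).
(* Then u1(- L + 1) <= 2 / (L - 2) = 2 / (2/k + 2) < k. *)
set (L := 2 / k + 4).
assert (H2k : 0 < 2 / k) by (apply Rdiv_lt_0_compat; lra).
assert (HuS : u1 (- L + 1) < k).
{ apply Rle_lt_trans with (2 / (- (- L + 1) - 1)); [apply (profile_decay1 s1 u u1); [easy|unfold L; lra]|].
  replace (- (- L + 1) - 1) with (2 / k + 2) by (unfold L; ring).
  apply Rlt_div_l; [lra|]. replace (k * (2 / k + 2)) with (2 + 2 * k) by (field; lra). lra. }
set (M := Rmax L s1).
assert (HM1 : 1 <= M) by (apply Rle_trans with L; [unfold L; lra|apply Rmax_l]).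
assert (HMs : s1 <= M) by apply Rmax_r.
set (r := Rmin 1 (eps / 4)). assert (Hr : 0 < r) by (apply Rmin_glb_lt; lra).
assert (Hr1 : r <= 1) by apply Rmin_l. assert (Hr2 : r <= eps / 4) by apply Rmin_r.
(* For q at least this large, d <= (2 M^2 + 1) / q <= r, that is at most 1 and at most eps/4. *)
exists ((2 * M ^ 2 + 1) / r). intros a q g HQ Ha Hq Hqa Hg Lg.
assert (HMM : 1 <= M ^ 2) by (simpl; nra).
assert (Hq1 : 1 <= q).
{ apply Rle_trans with (2 := HQ). apply Rle_div_r; lra. }
assert (Hqr : 2 * M ^ 2 + 1 <= q * r).
{ apply Rle_div_l in HQ; lra. }
set (d := 2 * M ^ 2 / q ^ 2 + 1 / q).
assert (Hq2 : 2 * M ^ 2 / q ^ 2 <= 2 * M ^ 2 / q).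
{ apply Rmult_le_compat_l; [lra|]. apply Rinv_le_contravar; [lra|simpl; nra]. }
assert (Hdr : d <= r).
{ unfold d. apply Rle_trans with ((2 * M ^ 2 + 1) / q); [|apply Rle_div_l; lra].
  replace ((2 * M ^ 2 + 1) / q) with (2 * M ^ 2 / q + 1 / q) by (field; lra). lra. }
assert (H1q : 0 < 1 / q) by (apply Rdiv_lt_0_compat; lra).
assert (Hqi : 0 < / q ^ 2) by (apply Rinv_0_lt_compat, pow_lt, Hq).
assert (HMq : M / q ^ 2 <= 1 / 2).
{ assert (M / q ^ 2 <= M ^ 2 / q ^ 2) by (apply Rmult_le_compat_r; [lra|simpl; nra]).
  replace (2 * M ^ 2 / q ^ 2) with (2 * (M ^ 2 / q ^ 2)) in * by (field; lra).
  unfold d in Hdr. lra. }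
pose proof (scaled_root_le a q g Ha Hq Hqa Hg Lg s1 u u1 P) as Hup.
pose proof (scaled_root_ge a q g Ha Hq Hqa Hg Lg s1 L e u u1 P) as Hlow.
cbv zeta in Hlow. fold M in Hlow. fold d in Hlow.
specialize (Hlow ltac:(unfold L; lra) HMq ltac:(lra) ltac:(lra) HuS).
pose proof (scaled_root_ge0 a q g Ha Hg Lg) as Hr0.
set (s := scaled_root q g) in *.
assert (Hsmall : Rabs (s / q ^ 2) <= 1 / 2).
{ rewrite Rabs_pos_eq by (apply Rmult_le_pos; lra). apply Rle_trans with (2 := HMq).
  apply Rmult_le_compat_r; lra. }
pose proof (scaled_mass_bounds a q g Hq Hqa Hg Hsmall) as HB. fold s in HB.
assert (H4 : 2 * s ^ 2 / q ^ 2 <= 2 * M ^ 2 / q ^ 2).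
{ apply Rmult_le_compat_r; [lra|]. nra. }
apply Rabs_lt_between. unfold d in *. lra.
Qed.

(** * Cube roots and the asymptotics of the moments *)

Definition cube_root (n : nat) : R := Rpower (INR n) (1 / 3).

Lemma cube_root_pos (n : nat) : 0 < cube_root n.
Proof. apply exp_pos. Qed.

Lemma cube_root_pow (n : nat) : (1 <= n)%nat -> cube_root n ^ 3 = INR n.
Proof.
intros Hn. unfold cube_root. rewrite <- Rpower_pow by apply exp_pos.
rewrite Rpower_mult. replace (1 / 3 * INR 3) with 1 by (simpl; field).
apply Rpower_1, lt_0_INR. lia.
Qed.

Lemma cube_root_pow2 (n : nat) : Rpower (INR n) (2 / 3) = cube_root n ^ 2.
Proof.
unfold cube_root. rewrite <- Rpower_pow by apply exp_pos.
rewrite Rpower_mult. f_equal. simpl. field.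
Qed.

Lemma cube_root_large (Q : R) : eventually (fun n => Q <= cube_root n).
Proof.
destruct (nfloor_ex (Rmax Q 0 ^ 3)) as [N HN]; [apply pow_le, Rmax_r|].
exists (S N). intros n Hn. apply Rnot_lt_le. intros Hlt.
pose proof (cube_root_pos n) as Hc. pose proof (cube_root_pow n ltac:(lia)) as Hp.
assert (cube_root n ^ 3 <= Rmax Q 0 ^ 3).
{ apply pow_incr. split; [lra|]. apply Rle_trans with (2 := Rmax_l Q 0). lra. }
apply le_INR in Hn. rewrite S_INR in Hn. lra.
Qed.

Lemma cube_root_inv_lim : is_lim_seq (fun n => / cube_root n) 0.
Proof.
apply is_lim_seq_spec. intros eps. destruct (cube_root_large (2 / eps)) as [N HN].
exists N. intros n Hn. specialize (HN n Hn). pose proof (cond_pos eps).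
pose proof (cube_root_pos n). rewrite Rminus_0_r, Rabs_pos_eq by (left; now apply Rinv_0_lt_compat).
apply Rle_div_l in HN; [|easy].
apply (Rmult_lt_reg_l (cube_root n)); [easy|]. rewrite Rinv_r; lra.
Qed.

Theorem theorem2 :
  (forall n : nat, (1 <= n)%nat ->
     exists c : nat -> R, solves n c /\
       (forall d : nat -> R, solves n d ->
          forall k : nat, (1 <= k)%nat -> d k = c k)) /\
  (forall a1 : R, largest_negative_zero (Derive Ai) a1 ->
   forall c : nat -> nat -> R,
     (forall n : nat, (1 <= n)%nat -> solves n (c n)) ->
     asymp_equiv (fun n => moment 0 (c n))
       (fun n => 1 / (Rabs a1 * Rpower (INR n) (1 / 3))) /\
     asymp_equiv (fun n => moment 2 (c n))
       (fun n => Rpower (INR n) (2 / 3) / Rabs a1)).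
Proof.
split.
- intros n Hn. destruct (solution_exists n Hn) as [c Hc]. exists c. split; [easy|].
  intros d Hd [|k] Hk; [lia|].
  destruct (critical_point_exists (INR n)) as [g [Hg Lg]]; [apply (le_INR 1); lia|].
  destruct (solution_moments n d g Hn Hd Hg Lg) as [-> _].
  now destruct (solution_moments n c g Hn Hc Hg Lg) as [-> _].
- intros a1 Ha1 c Hc.
  destruct (airy_profile_exists a1 Ha1) as [u [u1 P]].
  pose proof (profile_s1 _ _ _ P) as Hs1.
  set (s1 := Rabs a1) in *.
  set (E n := / real (moment 0 (c n))).
  assert (HE : forall n, (1 <= n)%nat -> exists g, 0 < g /\ is_lim_seq (fun N => psum (INR n) N g) 1 /\
     E n = 1 + INR n * (2 * g - 1) /\ 1 <= E n /\
     real (moment 2 (c n)) = 1 + (E n - 1 + INR n) / E n).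
  { intros n Hn. assert (Ha : 1 <= INR n) by (apply (le_INR 1); lia).
    destruct (critical_point_exists (INR n) Ha) as [g [Hg Lg]].
    pose proof (critical_ge_half _ g Ha Hg Lg).
    destruct (solution_moments n (c n) g Hn (Hc n Hn) Hg Lg) as [_ [M0 M2]].
    assert (HEn : E n = 1 + INR n * (2 * g - 1)) by (unfold E; rewrite M0; apply Rinv_inv).
    exists g. split; [easy|]. split; [easy|]. split; [easy|]. split; [rewrite HEn; nra|].
    rewrite M2, HEn. simpl real. f_equal. f_equal. ring. }
  assert (LE : is_lim_seq (fun n => E n / cube_root n) s1).
  { apply is_lim_seq_spec. intros eps.
    destruct (scaled_mass_limit s1 eps u u1 P (cond_pos eps)) as [Q HQ].
    destruct (cube_root_large Q) as [N HN]. exists (S N). intros n Hn.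
    destruct (HE n ltac:(lia)) as [g [Hg [Lg [-> _]]]].
    apply HQ; auto; [apply HN; lia|apply (le_INR 1); lia|apply cube_root_pos|apply cube_root_pow; lia]. }
  assert (LI : is_lim_seq (fun n => / (E n / cube_root n)) (/ s1)).
  { apply (is_lim_seq_inv _ s1 LE). intros H; injection H; lra. }
  split; unfold asymp_equiv.
  + apply is_lim_seq_ext_loc with (fun n => s1 * / (E n / cube_root n)).
    { exists 1%nat. intros n Hn. destruct (HE n Hn) as [g [_ [_ [_ [HE1 _]]]]].
      fold (cube_root n). pose proof (cube_root_pos n).
      replace (real (moment 0 (c n))) with (/ E n) by (unfold E; apply Rinv_inv).
      field. lra. }
    replace 1 with (s1 * / s1) by (field; lra).
    apply (is_lim_seq_scal_l _ s1 (/ s1) LI).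
  (* With q = n^(1/3) and E = 1/m_0, the quotient m_2 / q^2 equals 2/q^2 + q/E - (q/E) / q^3; only
     the middle term survives in the limit. *)
  + apply is_lim_seq_ext_loc with
      (fun n => s1 * (2 * (/ cube_root n * / cube_root n) + / (E n / cube_root n)
         - / (E n / cube_root n) * (/ cube_root n * (/ cube_root n * / cube_root n)))).
    { exists 1%nat. intros n Hn. destruct (HE n Hn) as [g [_ [_ [_ [HE1 ->]]]]].
      rewrite cube_root_pow2, <- (cube_root_pow n Hn). pose proof (cube_root_pos n).
      field. lra. }
    replace 1 with (s1 * (2 * (0 * 0) + / s1 - / s1 * (0 * (0 * 0)))) by (field; lra).
    pose proof cube_root_inv_lim as L0.
    apply (is_lim_seq_scal_l _ s1 (2 * (0 * 0) + / s1 - / s1 * (0 * (0 * 0)))).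
    apply is_lim_seq_minus'.
    * apply is_lim_seq_plus'; [|exact LI].
      apply (is_lim_seq_scal_l _ 2 (0 * 0)). now apply is_lim_seq_mult'.
    * apply is_lim_seq_mult'; [exact LI|]. apply is_lim_seq_mult'; [exact L0|]. now apply is_lim_seq_mult'.
Qed.
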